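(* Let $Z$ be an ACM fat point scheme in $\mathbb{P}^1\times\mathbb{P}^1$ with $\alpha_Z=(\alpha_1,\dots,\alpha_m)$ (non-increasing). Define $C_Z=\{(m,0),(0,\alpha_1)\}\cup\{(i-1,\alpha_i) : 2\le i\le m,\ \alpha_i<\alpha_{i-1}\}$ and $V_Z=\{(m,\alpha_m)\}\cup\{(i-1,\alpha_{i-1}) : 2\le i\le m,\ \alpha_i<\alpha_{i-1}\}$. Then the bigraded minimal free resolution of $I_Z$ is $$0\to\bigoplus_{(v_1,v_2)\in V_Z}R(-v_1,-v_2)\to\bigoplus_{(c_1,c_2)\in C_Z}R(-c_1,-c_2)\to I_Z\to 0.$$
   Context: $\mathbf{k}$ algebraically closed, $R=\mathbf{k}[x_0,x_1,y_0,y_1]$ bigraded with $\deg x_i=(1,0)$, $\deg y_i=(0,1)$; a fat point scheme $Z$ has ideal $I_Z=\bigcap\wp_{P_k}^{m_k}$ (where $[a_0:a_1]\times[b_0:b_1]$ has ideal $(a_1x_0-a_0x_1,b_1y_0-b_0y_1)$) and is ACM if $R/I_Z$ is Cohen–Macaulay. With $\pi_1(\mathrm{Supp}\,Z)=\{R_1,\dots,R_r\}$, $\pi_2(\mathrm{Supp}\,Z)=\{Q_1,\dots,Q_t\}$ and $m_{ij}$ the multiplicity of $R_i\times Q_j$ ($0$ if absent): $l_i=\max_j m_{ij}$, $a_{i,k}=\sum_j(m_{ij}-k)_+$ ($0\le k\le l_i-1$, $(n)_+=\max\{0,n\}$), and $\alpha_Z$ is the tuple of all $a_{i,k}$ in non-increasing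 order. $R(-a,-b)$ denotes $R$ with bigrading shifted by $(a,b)$. *)

(* Defs.v *)
From mathcomp Require Import all_boot all_order all_algebra.
From mathcomp Require Import mpoly.
Set Implicit Arguments. Unset Strict Implicit. Unset Printing Implicit Defensive.
Import Order.TTheory GRing.Theory.
Local Open Scope ring_scope.

(* Variables: 'X_0 = x0, 'X_1 = x1, 'X_2 = y0, 'X_3 = y1. *)
Section Defs.
Variable k : closedFieldType.
Local Notation R := {mpoly k[4]}.

Definition i0 : 'I_4 := @Ordinal 4 0 isT.
Definition i1 : 'I_4 := @Ordinal 4 1 isT.
Definition i2 : 'I_4 := @Ordinal 4 2 isT.
Definition i3 : 'I_4 := @Ordinal 4 3 isT.

Definition bideg (m : 'X_{1..4}) : nat * nat := ((m i0 + m i1)%N, (m i2 + m i3)%N).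

(* p is bihomogeneous of bidegree d (0 is bihomogeneous of every bidegree) *)
Definition bihomog (p : R) (d : nat * nat) : Prop :=
  forall m, m \in msupp p -> bideg m = d.

(* ideals of R are represented as predicates R -> Prop *)
Definition ideal_mul (I J : R -> Prop) : R -> Prop := fun p =>
  exists s : seq (R * R), (forall x, x \in s -> I x.1 /\ J x.2) /\
    p = \big[+%R/0]_(x <- s) (x.1 * x.2).

Definition ideal_pow (I : R -> Prop) (n : nat) : R -> Prop :=
  iter n (ideal_mul I) (fun _ => True).

Definition ideal_gen (gs : seq R) : R -> Prop := fun p =>
  exists rs : seq R, size rs = size gs /\
    p = \big[+%R/0]_(i < size gs) (rs`_i * gs`_i).

Definition ideal_add_gen (I : R -> Prop) (gs : seq R) : R -> Prop := fun p =>
  exists a b, I a /\ ideal_gen gs b /\ p = a + b.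

(* ideal of [a0:a1] x [b0:b1] : (a1 x0 - a0 x1, b1 y0 - b0 y1) *)
Definition point_ideal (a b : k * k) : R -> Prop :=
  ideal_gen [:: a.2%:MP * 'X_i0 - a.1%:MP * 'X_i1;
                b.2%:MP * 'X_i2 - b.1%:MP * 'X_i3].

Definition P1pt (a : k * k) : Prop := a != (0, 0).
Definition P1_distinct (a b : k * k) : Prop := a.1 * b.2 != a.2 * b.1.

(* I_Z = intersection of wp_{R_i x Q_j}^{m_ij}  (m_ij = 0 gives the unit ideal) *)
Definition IZ (r t : nat) (Rp : 'I_r -> k * k) (Qp : 'I_t -> k * k)
  (mu : 'I_r -> 'I_t -> nat) : R -> Prop := fun p =>
  forall i j, ideal_pow (point_ideal (Rp i) (Qp j)) (mu i j) p.

Definition is_ideal (I : R -> Prop) : Prop :=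
  I 0 /\ (forall a b, I a -> I b -> I (a + b)) /\ (forall a b, I b -> I (a * b)).

Definition is_prime (P : R -> Prop) : Prop :=
  is_ideal P /\ ~ P 1 /\ (forall a b, P (a * b) -> P a \/ P b).

Definition prime_chain (I : R -> Prop) (n : nat) (P : nat -> R -> Prop) : Prop :=
  (forall i, (i <= n)%N -> is_prime (P i) /\ (forall x, I x -> P i x)) /\
  (forall i, (i < n)%N -> (forall x, P i x -> P i.+1 x) /\
                          exists x, P i.+1 x /\ ~ P i x).

Definition krull_dim_quot (I : R -> Prop) (n : nat) : Prop :=
  (exists P, prime_chain I n P) /\ (forall m P, prime_chain I m P -> (m <= n)%N).

Definition irrelevant : R -> Prop := ideal_gen [:: 'X_i0; 'X_i1; 'X_i2; 'X_i3].

Definition regular_seq (I : R -> Prop) (fs : seq R) : Prop :=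
  (forall f, f \in fs -> irrelevant f) /\
  (forall j, (j < size fs)%N -> forall a,
      ideal_add_gen I (take j fs) (a * fs`_j) -> ideal_add_gen I (take j fs) a) /\
  ~ ideal_add_gen I fs 1.

Definition depth_quot (I : R -> Prop) (n : nat) : Prop :=
  (exists fs, size fs = n /\ regular_seq I fs) /\
  (forall fs, regular_seq I fs -> (size fs <= n)%N).

(* R/I Cohen-Macaulay (graded setting: depth_m R/I = dim R/I) *)
Definition CohenMacaulay_quot (I : R -> Prop) : Prop :=
  exists n, krull_dim_quot I n /\ depth_quot I n.

(* bigraded minimal free resolution
   0 -> (+)_{v in V} R(-v) --M--> (+)_{c in C} R(-c) --g--> I -> 0 *)
Definition bigraded_min_resolution (I : R -> Prop) (C V : seq (nat * nat)) : Prop :=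
  exists (g : 'cV[R]_(size C)) (M : 'M[R]_(size V, size C)),
    (forall c : 'I_(size C), bihomog (g c ord0) (nth (0, 0)%N C c)) /\
    (forall (v : 'I_(size V)) (c : 'I_(size C)) m, m \in msupp (M v c) ->
        ((bideg m).1 + (nth (0, 0)%N C c).1 = (nth (0, 0)%N V v).1)%N /\
        ((bideg m).2 + (nth (0, 0)%N C c).2 = (nth (0, 0)%N V v).2)%N) /\
    (forall p, I p <-> exists u : 'rV[R]_(size C), p = (u *m g) ord0 ord0) /\
    (forall u : 'rV[R]_(size C), u *m g = 0 <-> exists w : 'rV[R]_(size V), u = w *m M) /\
    (forall w : 'rV[R]_(size V), w *m M = 0 -> w = 0) /\
    (* minimality: entries of M lie in m (no nonzero constants) *)
    (forall v c, (M v c)@_0%MM = 0).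

End Defs.

Definition l_i (r t : nat) (mu : 'I_r -> 'I_t -> nat) (i : 'I_r) : nat :=
  (\max_(j < t) mu i j)%N.
Definition a_ik (r t : nat) (mu : 'I_r -> 'I_t -> nat) (i : 'I_r) (k : nat) : nat :=
  (\sum_(j < t) (mu i j - k))%N.
Definition alphaZ (r t : nat) (mu : 'I_r -> 'I_t -> nat) : seq nat :=
  sort geq (flatten [seq [seq a_ik mu i k | k <- iota 0 (l_i mu i)] | i <- enum 'I_r]).

(* alpha_i (1-indexed) = nth 0 a (i-1);  m = size a *)
Definition CZ (a : seq nat) : seq (nat * nat) :=
  (size a, 0%N) :: (0%N, nth 0%N a 0) ::
  [seq (i.-1, nth 0%N a i.-1) | i <- iota 2 (size a).-1 & (nth 0%N a i.-1 < nth 0%N a i.-2)%N].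
Definition VZ (a : seq nat) : seq (nat * nat) :=
  (size a, nth 0%N a (size a).-1) ::
  [seq (i.-1, nth 0%N a i.-2) | i <- iota 2 (size a).-1 & (nth 0%N a i.-1 < nth 0%N a i.-2)%N].

(* Main.v *)
(** If Z is ACM then dim R/I_Z >= 2 yields a regular sequence of length two in the irrelevant
    ideal, hence a generic x-form l and a generic y-form l' also form a regular sequence on
    R/I_Z.  Each x-degree d part of R/(I_Z + (l)) is then saturated as a k[y0,y1]-module, so it
    is presented by a single form F_d = prod_j V_j^(e_j(d)), computed one column at a time.
    Lifting F_d to I_Z gives H(x) F_d(y) in I_Z with deg H = d, which bounds
    sum_i max_j (mu_ij - e_j(d))_+ by d for every d; this forces the truncated rows
    ((mu_ij - a)_+)_j to be totally ordered.

    Given the total order, let row i dominate all the others, and let Z' be Z with the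
    multiplicities of row i lowered by one.  Then I_Z = L_i I_Z' + (prod_j V_j^(mu_ij)), and
    alpha_Z is alpha_Z' with sum_j mu_ij added in front.  A resolution of I_Z' extends to one
    of I_Z: with one more generator and one more syzygy if the new entry of alpha_Z is strictly
    larger than the next one, and with the same ranks if it is equal. *)
Require Import Defs.
From HB Require Import structures.
From mathcomp Require Import all_boot all_order all_algebra all_fingroup.
From mathcomp Require Import mpoly.
From mathcomp Require Import ring zify.
Set Implicit Arguments. Unset Strict Implicit. Unset Printing Implicit Defensive.
Import Order.TTheory GRing.Theory.
Local Open Scope ring_scope.

(** * Ideals generated by monomials in a coordinate system *)

Section Ideals.
Variable k : closedFieldType.
Local Notation R := {mpoly k[4]}.
Implicit Types (I J : R -> Prop) (p q u v w : R).

Lemma ideal_zero I : is_ideal I -> I 0. Proof. by case. Qed.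
Lemma ideal_addr I p q : is_ideal I -> I p -> I q -> I (p + q).
Proof. by case=> _ [h _]; apply: h. Qed.
Lemma ideal_mull I p q : is_ideal I -> I q -> I (p * q).
Proof. by case=> _ [_ h]; apply: h. Qed.
Lemma ideal_mulr I p q : is_ideal I -> I q -> I (q * p).
Proof. by rewrite mulrC; apply: ideal_mull. Qed.
Lemma ideal_oppr I p : is_ideal I -> I p -> I (- p).
Proof. by move=> hI hp; rewrite -mulN1r; apply: ideal_mull. Qed.
Lemma ideal_subr I p q : is_ideal I -> I p -> I q -> I (p - q).
Proof. by move=> hI hp hq; apply: ideal_addr => //; apply: ideal_oppr. Qed.
Lemma ideal_sum I (T : eqType) (s : seq T) (F : T -> R) :
  is_ideal I -> (forall i, i \in s -> I (F i)) -> I (\sum_(i <- s) F i).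
Proof.
move=> hI hF; rewrite big_seq_cond; apply: big_ind.
- exact: ideal_zero.
- by move=> *; apply: ideal_addr.
- by move=> i /andP[/hF].
Qed.

Definition divides u p := exists h, p = u * h.

Lemma divides_ideal u : is_ideal (divides u).
Proof.
split; first by exists 0; rewrite mulr0.
split=> [a b [x ->] [y ->]|a b [x ->]]; first by exists (x + y); rewrite mulrDr.
by exists (a * x); rewrite mulrCA.
Qed.

Definition addI I u p := exists a b, I a /\ p = a + u * b.

Lemma addI_ideal I u : is_ideal I -> is_ideal (addI I u).
Proof.
move=> hI; split; first by exists 0, 0; rewrite mulr0 addr0; split=> //; apply: ideal_zero.
split=> [_ _ [a [b [ha ->]]] [c [d [hc ->]]]|r _ [a [b [ha ->]]]].
  by exists (a + c), (b + d); split; [apply: ideal_addr | ring].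
by exists (r * a), (r * b); split; [apply: ideal_mull | ring].
Qed.

Lemma addI_sub I u p : I p -> addI I u p.
Proof. by move=> hp; exists p, 0; rewrite mulr0 addr0. Qed.

Lemma addI_gen I u : is_ideal I -> addI I u u.
Proof. by move=> hI; exists 0, 1; rewrite mulr1 add0r; split=> //; apply: ideal_zero. Qed.

Lemma colon_ideal I w : is_ideal I -> is_ideal (fun p => I (w * p)).
Proof.
move=> hI; split; first by rewrite mulr0; apply: ideal_zero.
split=> [a b ha hb|a b hb]; first by rewrite mulrDr; apply: ideal_addr.
by rewrite mulrCA; apply: ideal_mull.
Qed.

(** The n-th power of the ideal (u, v). The recursion hands out two cofactors in the previous power
    instead of a list of products. *)
Fixpoint powI u v n p : Prop :=
  if n is n'.+1 then exists a b, [/\ powI u v n' a, powI u v n' b & p = u * a + v * b]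
  else True.

Lemma powI_ideal u v n : is_ideal (powI u v n).
Proof.
elim: n => [//|n IH]; split; first by exists 0, 0; rewrite !mulr0 addr0; split=> //; apply: ideal_zero.
split=> [_ _ [a [b [ha hb ->]]] [c [d [hc hd ->]]]|r _ [a [b [ha hb ->]]]].
  by exists (a + c), (b + d); split; [apply: ideal_addr|apply: ideal_addr | ring].
by exists (r * a), (r * b); split; [apply: ideal_mull|apply: ideal_mull | ring].
Qed.

Lemma powIC u v n p : powI u v n p -> powI v u n p.
Proof.
elim: n p => [//|n IH] p [a [b [ha hb ->]]].
by exists b, a; split; [apply: IH|apply: IH|rewrite addrC].
Qed.

Lemma powIS u v n p : powI u v n p -> powI u v n.+1 (u * p).
Proof.
move=> h; exists p, 0; split=> //; last by rewrite mulr0 addr0.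
exact: ideal_zero (powI_ideal _ _ _).
Qed.

Lemma powI_exp u v n a b : (n <= a + b)%N -> powI u v n (u ^+ a * v ^+ b).
Proof.
elim: n a b => [//|n IH] [|a] b; rewrite ?add0n ?addSn.
  case: b => [//|b] hb; rewrite mul1r exprS; apply/powIC/powIS/powIC.
  by rewrite -[_ ^+ _]mul1r -(expr0 u); apply: IH.
by move=> hb; rewrite exprS -mulrA; apply/powIS/IH.
Qed.

Lemma ideal_gen2P u v p : ideal_gen [:: u; v] p <-> exists a b, p = a * u + b * v.
Proof.
split=> [[rs [_ ->]]|[a [b ->]]].
  by exists rs`_0, rs`_1; rewrite big_ord_recl big_ord1.
by exists [:: a; b]; rewrite big_ord_recl big_ord1.
Qed.

Lemma ideal_powP u v n p : ideal_pow (ideal_gen [:: u; v]) n p <-> powI u v n p.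
Proof.
elim: n p => [//|n IH] p; split.
  case=> s [hs ->]; apply: ideal_sum; first exact: powI_ideal.
  move=> x /hs[/ideal_gen2P[a [b ->]] /IH hx].
  exists (a * x.2), (b * x.2); split; last by ring.
    by apply: ideal_mull => //; apply: powI_ideal.
  by apply: ideal_mull => //; apply: powI_ideal.
case=> a [b [/IH ha /IH hb ->]]; exists [:: (u, a); (v, b)]; split.
  move=> x; rewrite !inE => /orP[] /eqP-> /=; split=> //; apply/ideal_gen2P.
    by exists 1, 0; ring.
  by exists 0, 1; ring.
by rewrite big_cons big_seq1.
Qed.

(** Modulo u, the power (u, v)^n collapses to (v^n). *)
Lemma powI_mod u v n p : powI u v n p -> exists a b, p = u * a + v ^+ n * b.
Proof.
elim: n p => [|n IH] p; first by exists 0, p; rewrite mulr0 add0r mul1r.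
case=> a [_ [_ /IH[c [d ->]] ->]]; exists (a + v * c), d; rewrite exprS; ring.
Qed.

Definition mono (S : pred 'X_{1..4}) p := forall m, p@_m != 0 -> S m.

Section Coordinates.
Variable Phi : {rmorphism R -> R}.
Hypothesis bijPhi : bijective Phi.

(** For an upward closed set [S] of exponents this is a monomial ideal in the coordinates
    [Phi 'X_i]. Ideals brought to this form have colons that can be read off from exponents. *)
Definition monoI S p := exists2 q, mono S q & p = Phi q.

(** Multiplication by a coordinate shifts all exponents by [U_(i)] and leaves the coefficients
    alone. *)
Lemma monoI_colon (S S' : pred 'X_{1..4}) i q :
  (forall m, S (U_(i) + m)%MM -> S' m) -> monoI S (Phi 'X_i * q) -> monoI S' q.
Proof.
case: bijPhi => Psi PhiK PsiK hS [P hP E]; exists (Psi q); last by rewrite PsiK.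
move=> m hm; apply/hS/hP.
have -> : P = Psi q * 'X_i.
  by apply: (bij_inj bijPhi); rewrite -E rmorphM PsiK mulrC.
by rewrite mcoeffMX.
Qed.

Lemma monoI_ideal (S : pred 'X_{1..4}) :
  (forall m m', S m -> S (m' + m)%MM) -> is_ideal (monoI S).
Proof.
case: bijPhi => Psi PhiK PsiK hS; split.
  by exists 0; rewrite ?rmorph0 // => m; rewrite mcoeff0 eqxx.
split=> [_ _ [p hp ->] [q hq ->]|a _ [p hp ->]].
  exists (p + q); rewrite ?rmorphD // => m; rewrite mcoeffD.
  by have [->|/hp//] := eqVneq p@_m 0; rewrite add0r => /hq.
exists (Psi a * p); rewrite ?rmorphM ?PsiK // => m.
rewrite -mcoeff_msupp => /msuppM_le /allpairsP[[x y] /= [_ hy ->]].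
by apply/hS/hp; rewrite -mcoeff_msupp.
Qed.

Lemma monoIX (S : pred 'X_{1..4}) m : S m -> monoI S (Phi 'X_[m]).
Proof.
move=> Sm; exists 'X_[m] => // m'; rewrite mcoeffX.
by have [<-|] := eqVneq m m'; rewrite //= eqxx.
Qed.

Lemma monoI_sub (S : pred 'X_{1..4}) I p :
  is_ideal I -> (forall m, S m -> I (Phi 'X_[m])) -> monoI S p -> I p.
Proof.
move=> hI hS [q hq ->]; rewrite [q]mpolyE rmorph_sum; apply: ideal_sum => // m.
rewrite mcoeff_msupp => hm; rewrite -mul_mpolyC rmorphM; apply: ideal_mull => //.
by apply/hS/hq.
Qed.

Lemma divides_monoI i n p : divides (Phi 'X_i ^+ n) p <-> monoI (fun m => n <= m i)%N p.
Proof.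
have hI : is_ideal (monoI (fun m => n <= m i)%N).
  by apply: monoI_ideal => m m' h; rewrite mnmDE; lia.
split=> [[h ->]|].
  apply: ideal_mulr => //; rewrite -rmorphXn mpolyXn; apply: monoIX.
  by rewrite mulmnE mnm1E eqxx mul1n.
apply: monoI_sub; first exact: divides_ideal.
move=> m hm; rewrite -rmorphXn mpolyXn.
have -> : m = (U_(i) *+ n + (m - U_(i) *+ n))%MM.
  rewrite addmC submK //; apply/mnm_lepP => j; rewrite mulmnE mnm1E.
  by have [<-|//] := eqVneq i j; rewrite mul1n.
by rewrite mpolyXD rmorphM; exists (Phi 'X_[m - U_(i) *+ n]).
Qed.

Lemma dividesX_colon i l n q : i != l ->
  divides (Phi 'X_i ^+ n) (Phi 'X_l * q) -> divides (Phi 'X_i ^+ n) q.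
Proof.
move=> il /divides_monoI h; apply/divides_monoI; apply: monoI_colon h => m.
by rewrite mnmDE mnm1E eq_sym (negPf il).
Qed.

Lemma powI_monoI i j n p : i != j ->
  powI (Phi 'X_i) (Phi 'X_j) n p <-> monoI (fun m => n <= m i + m j)%N p.
Proof.
move=> ij; have hI a : is_ideal (monoI (fun m => a <= m i + m j)%N).
  by apply: monoI_ideal => m m' h; rewrite !mnmDE; lia.
split.
  elim: n p => [|n IH] p.
    by move=> _; case: bijPhi => Psi PhiK PsiK; exists (Psi p); rewrite ?PsiK.
  have shift l q : (0 < (U_(l)%MM : 'X_{1..4}) i + U_(l)%MM j)%N ->
      monoI (fun m => n <= m i + m j)%N q -> monoI (fun m => n < m i + m j)%N (Phi 'X_l * q).
    move=> hl; apply: (monoI_sub (colon_ideal (Phi 'X_l) (hI n.+1))).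
    by move=> m hm; rewrite -rmorphM -mpolyXD; apply: monoIX; rewrite !mnmDE; lia.
  case=> a [b [/IH ha /IH hb ->]]; apply: ideal_addr => //; apply: shift => //.
    by rewrite mnm1E eqxx.
  by rewrite !mnm1E eqxx addnC.
apply: monoI_sub; first exact: powI_ideal.
move=> m hm; have -> : m = (U_(i) *+ m i + U_(j) *+ m j + (m - (U_(i) *+ m i + U_(j) *+ m j)))%MM.
  rewrite addmC submK //; apply/mnm_lepP => l; rewrite mnmDE !mulmnE !mnm1E.
  have [<-|il] := eqVneq i l; first by rewrite eq_sym (negPf ij) mul1n mul0n addn0.
  by have [<-|jl] := eqVneq j l; rewrite !mul0n ?mul1n.
rewrite !mpolyXD !rmorphM -!mpolyXn !rmorphXn; apply: ideal_mulr; first exact: powI_ideal.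
exact: powI_exp.
Qed.

Lemma powI_colon_gen i j n q : i != j ->
  powI (Phi 'X_i) (Phi 'X_j) n.+1 (Phi 'X_i * q) -> powI (Phi 'X_i) (Phi 'X_j) n q.
Proof.
move=> ij /(powI_monoI _ _ ij) h; apply/(powI_monoI _ _ ij); apply: monoI_colon h => m.
by rewrite !mnmDE !mnm1E eqxx (negPf ij); lia.
Qed.

(** The exponents of the coordinates i and j alone decide membership, so any other coordinate is a
    nonzerodivisor modulo the power. *)
Lemma powI_colon_other i j l n q : i != j -> l != i -> l != j ->
  powI (Phi 'X_i) (Phi 'X_j) n (Phi 'X_l * q) -> powI (Phi 'X_i) (Phi 'X_j) n q.
Proof.
move=> ij li lj /(powI_monoI _ _ ij) h; apply/(powI_monoI _ _ ij); apply: monoI_colon h => m.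
by rewrite !mnmDE !mnm1E (negPf li) (negPf lj).
Qed.

Definition sumI u v p := exists a b, p = u * a + v * b.

Lemma sumI_ideal u v : is_ideal (sumI u v).
Proof.
split; first by exists 0, 0; ring.
split=> [_ _ [a [b ->]] [c [d ->]]|r _ [a [b ->]]].
  by exists (a + c), (b + d); ring.
by exists (r * a), (r * b); ring.
Qed.

Lemma sumI_monoI i j n p :
  sumI (Phi 'X_i) (Phi 'X_j ^+ n) p <-> monoI (fun m => (0 < m i) || (n <= m j))%N p.
Proof.
have hI : is_ideal (monoI (fun m => (0 < m i) || (n <= m j))%N).
  by apply: monoI_ideal => m m' h; rewrite !mnmDE; lia.
split=> [[a [b ->]]|].
  apply: ideal_addr => //; apply: ideal_mulr => //.
    by apply: monoIX; rewrite mnm1E eqxx.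
  by rewrite -rmorphXn mpolyXn; apply: monoIX; rewrite !mulmnE !mnm1E eqxx mul1n leqnn orbT.
apply: monoI_sub; first exact: sumI_ideal.
move=> m /orP[] hm.
  have /divides_monoI[h ->] : monoI (fun m => 1 <= m i)%N (Phi 'X_[m]) by apply: monoIX.
  by exists h, 0; ring.
have /divides_monoI[h ->] : monoI (fun m => n <= m j)%N (Phi 'X_[m]) by apply: monoIX.
by exists 0, h; ring.
Qed.

Lemma sumI_colon i j l n q : l != i -> l != j ->
  sumI (Phi 'X_i) (Phi 'X_j ^+ n) (Phi 'X_l * q) -> sumI (Phi 'X_i) (Phi 'X_j ^+ n) q.
Proof.
move=> li lj /sumI_monoI h; apply/sumI_monoI; apply: monoI_colon h => m.
by rewrite !mnmDE !mnm1E (negPf li) (negPf lj).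
Qed.

End Coordinates.
End Ideals.

(** * Linear forms and bihomogeneous components *)

Section LinearForms.
Variable k : closedFieldType.
Local Notation R := {mpoly k[4]}.
Implicit Types (s : bool) (a b c : k * k) (p q u v w : R).

(* [var false] gives the indices of x0, x1 and [var true] those of y0, y1. *)
Definition var s (i : bool) : 'I_4 :=
  if s then (if i then i3 else i2) else (if i then i1 else i0).

(** The form vanishing at the point a of one of the two projective lines; [s] selects the line. *)
Definition lin s a : R := a.2%:MP * 'X_(var s false) - a.1%:MP * 'X_(var s true).

Lemma P1_complement a : P1pt a -> exists b, P1_distinct a b.
Proof.
case: a => x y; rewrite /P1pt xpair_eqE negb_and /P1_distinct /= => /orP[] h.
  by exists (0, 1); rewrite mulr1 mulr0.
by exists (1, 0); rewrite mulr1 mulr0 eq_sym.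
Qed.

Lemma lin_comb s a b (x y : k) :
  lin s (x * a.1 + y * b.1, x * a.2 + y * b.2) = x%:MP * lin s a + y%:MP * lin s b.
Proof. by rewrite /lin /= !mpolyCD !mpolyCM; ring. Qed.

Lemma lin_span s a b c : P1_distinct a b ->
  exists x y, lin s c = x%:MP * lin s a + y%:MP * lin s b.
Proof.
case: a b c => [a1 a2] [b1 b2] [c1 c2]; rewrite /P1_distinct /= -subr_eq0 => D0.
exists ((c1 * b2 - c2 * b1) / (a1 * b2 - a2 * b1)), ((a1 * c2 - a2 * c1) / (a1 * b2 - a2 * b1)).
by rewrite -lin_comb /=; congr lin; congr pair; field.
Qed.

Lemma varE s i : 'X_(var s i) = lin s (if i then (-1, 0) else (0, 1)) :> R.
Proof. by case: i; rewrite /lin /= ?mpolyCN mpolyC1 mpolyC0; ring. Qed.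

Lemma mpoly_morph_eq (F G : {rmorphism R -> R}) :
  (forall x : k, F x%:MP = G x%:MP) -> (forall i, F 'X_i = G 'X_i) -> F =1 G.
Proof.
move=> FC FX p; rewrite [p]mpolyE !rmorph_sum; apply: eq_bigr => m _.
rewrite -!mul_mpolyC !rmorphM FC mpolyXE_id !rmorph_prod; congr (_ * _).
by apply: eq_bigr => i _; rewrite !rmorphXn; congr (_ ^+ _); apply: FX.
Qed.

Definition lin_subst (a a' : bool -> k * k) : R -> R :=
  comp_mpoly [tuple lin false (a false); lin false (a' false); lin true (a true); lin true (a' true)].

HB.instance Definition _ (a a' : bool -> k * k) := GRing.RMorphism.on (lin_subst a a').

Lemma lin_substX (a a' : bool -> k * k) s i :
  lin_subst a a' 'X_(var s i) = lin s (if i then a' s else a s).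
Proof. by case: s; case: i; rewrite /lin_subst comp_mpolyXU. Qed.

Lemma lin_substC (a a' : bool -> k * k) x : lin_subst a a' x%:MP = x%:MP.
Proof. exact: comp_mpolyC. Qed.

Lemma lin_subst_lin (a a' : bool -> k * k) s c : lin_subst a a' (lin s c) =
  lin s (c.2 * (a s).1 - c.1 * (a' s).1, c.2 * (a s).2 - c.1 * (a' s).2).
Proof.
rewrite {1}/lin rmorphB !rmorphM /= !lin_substC !lin_substX /lin /=.
by rewrite !mpolyCB !mpolyCM; ring.
Qed.

Lemma ord4_var (i : 'I_4) : exists s (j : bool), i = var s j.
Proof.
case: i => -[|[|[|[|//]]]] hi.
- by exists false, false; apply: val_inj.
- by exists false, true; apply: val_inj.
- by exists true, false; apply: val_inj.
- by exists true, true; apply: val_inj.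
Qed.

Lemma lin_subst_bij (a a' : bool -> k * k) : (forall s, P1_distinct (a s) (a' s)) -> bijective (lin_subst a a').
Proof.
(* The substitution is a 2 by 2 matrix of determinant [D s] on each pair of variables; [b] and [b']
   are the inverse matrix, written as points. *)
move=> aa'; pose D s := (a s).1 * (a' s).2 - (a s).2 * (a' s).1.
have D0 s : D s != 0 by rewrite subr_eq0; apply: aa'.
pose b s := (- (a s).1 / D s, - (a' s).1 / D s).
pose b' s := (- (a s).2 / D s, - (a' s).2 / D s).
exists (lin_subst b b').
  apply: (@mpoly_morph_eq (lin_subst b b' \o lin_subst a a') idfun) => [x|i] /=.
    by rewrite !lin_substC.
  have [s [c ->]] := ord4_var i; rewrite lin_substX lin_subst_lin varE; congr lin.
  by have := D0 s; rewrite /b /b' /D; case: (c) => h /=; congr pair; field.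
apply: (@mpoly_morph_eq (lin_subst a a' \o lin_subst b b') idfun) => [x|i] /=.
  by rewrite !lin_substC.
have [s [c ->]] := ord4_var i; rewrite lin_substX lin_subst_lin varE; congr lin.
by have := D0 s; rewrite /b /b' /D; case: (c) => h /=; congr pair; field.
Qed.

(** Two distinct points on each line can be taken as coordinate points. The cancellation rules below
    thereby reduce to statements about exponents. *)
Lemma lin_coords s a a' b b' : P1_distinct a a' -> P1_distinct b b' ->
  exists2 Phi : {rmorphism R -> R}, bijective Phi &
    [/\ Phi 'X_(var s false) = lin s a, Phi 'X_(var s true) = lin s a',
        Phi 'X_(var (~~ s) false) = lin (~~ s) b & Phi 'X_(var (~~ s) true) = lin (~~ s) b'].
Proof.
move=> ha hb; pose f s' := if s' == s then a else b; pose f' s' := if s' == s then a' else b'.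
exists (lin_subst f f').
  by apply: lin_subst_bij => s'; rewrite /f /f'; case: eqP.
by split; rewrite /= lin_substX /f /f' ?eqxx //; case: (s).
Qed.

Lemma powI_lin_same s a b n q : P1pt a -> P1pt b ->
  powI (lin s a) (lin (~~ s) b) n.+1 (lin s a * q) -> powI (lin s a) (lin (~~ s) b) n q.
Proof.
move=> /P1_complement[a' ha] /P1_complement[b' hb].
have [Phi bPhi [<- _ <- _]] := lin_coords s ha hb.
by apply: powI_colon_gen => //; case: (s).
Qed.

Lemma powI_lin_other s a a' b n q : P1_distinct a a' -> P1pt b ->
  powI (lin s a) (lin (~~ s) b) n (lin s a' * q) -> powI (lin s a) (lin (~~ s) b) n q.
Proof.
move=> ha /P1_complement[b' hb].
have [Phi bPhi [<- <- <- _]] := lin_coords s ha hb.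
by apply: powI_colon_other => //; case: (s).
Qed.

Lemma divides_lin_same s a a' n q : P1_distinct a a' ->
  divides (lin s a ^+ n) (lin s a' * q) -> divides (lin s a ^+ n) q.
Proof.
move=> ha; have [Phi bPhi [<- <- _ _]] := lin_coords s ha ha.
by apply: dividesX_colon => //; case: (s).
Qed.

Lemma divides_lin_other s a b q : P1pt a -> P1pt b ->
  divides (lin s a) (lin (~~ s) b * q) -> divides (lin s a) q.
Proof.
move=> /P1_complement[a' ha] /P1_complement[b' hb].
have [Phi bPhi [<- _ <- _]] := lin_coords s ha hb.
by rewrite -[Phi 'X_(var s false)]expr1; apply: dividesX_colon => //; case: (s).
Qed.

Lemma sumI_lin s a b b' n q : P1pt a -> P1_distinct b b' ->
  sumI (lin s a) (lin (~~ s) b ^+ n) (lin (~~ s) b' * q) -> sumI (lin s a) (lin (~~ s) b ^+ n) q.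
Proof.
move=> /P1_complement[a' ha] hb.
have [Phi bPhi [<- _ <- <-]] := lin_coords s ha hb.
by apply: sumI_colon => //; case: (s).
Qed.

Lemma strip_exp (P : R -> Prop) v : (forall q, P (v * q) -> P q) ->
  forall n q, P (v ^+ n * q) -> P q.
Proof. by move=> h; elim=> [|n IH] q; rewrite ?mul1r // exprS -mulrA => /h/IH. Qed.

Lemma strip_prod (P : R -> Prop) (T : eqType) (r : seq T) (v : T -> R) (n : T -> nat) q :
  (forall i q, i \in r -> P (v i * q) -> P q) -> P ((\prod_(i <- r) v i ^+ n i) * q) -> P q.
Proof.
elim: r q => [|x r IH] q h; first by rewrite big_nil mul1r.
rewrite big_cons -mulrA => /(@strip_exp P (v x)) H; apply: IH; last first.
  by apply: H => q'; apply: h; rewrite mem_head.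
by move=> i q' hi; apply: h; rewrite inE hi orbT.
Qed.

(** Modulo [lin s a], each condition says that a power of one form of the other block divides p.
    Forms at distinct points are coprime modulo [lin s a], so their product divides p as well. *)
Lemma powI_mod_prod s a (T : eqType) (r : seq T) (b : T -> k * k) (n : T -> nat) p :
  uniq r -> P1pt a ->
  {in r &, forall i j, i != j -> P1_distinct (b i) (b j)} ->
  {in r, forall i, powI (lin s a) (lin (~~ s) (b i)) (n i) p} ->
  sumI (lin s a) (\prod_(i <- r) lin (~~ s) (b i) ^+ n i) p.
Proof.
move=> + ha; elim: r => [|x r IH] /=; first by move=> *; exists 0, p; rewrite big_nil; ring.
move=> /andP[xr ur] hb hp; have [||q [h E]] := IH ur.
- by move=> i j hi hj; apply: hb; rewrite inE ?hi ?hj orbT.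
- by move=> i hi; apply: hp; rewrite inE hi orbT.
have [c [d E']] := powI_mod (hp x (mem_head _ _)).
(* Two expressions for p are compared modulo [lin s a]; cancelling the product then leaves
   divisibility of the cofactor h. *)
have H : sumI (lin s a) (lin (~~ s) (b x) ^+ n x) ((\prod_(i <- r) lin (~~ s) (b i) ^+ n i) * h).
  by exists (c - q), d; rewrite mulrBr addrAC -E' E; ring.
have [|e [f Eh]] := strip_prod _ H.
  move=> i q' hi; apply: sumI_lin => //; apply: hb; rewrite ?inE ?eqxx ?hi ?orbT //.
  by apply: contraNneq xr => ->.
by exists (q + (\prod_(i <- r) lin (~~ s) (b i) ^+ n i) * e), f; rewrite big_cons E Eh; ring.
Qed.

Lemma divides_prod s (T : eqType) (r : seq T) (b : T -> k * k) (n : T -> nat) p :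
  uniq r -> {in r &, forall i j, i != j -> P1_distinct (b i) (b j)} ->
  {in r, forall i, divides (lin s (b i) ^+ n i) p} ->
  divides (\prod_(i <- r) lin s (b i) ^+ n i) p.
Proof.
elim: r => [|x r IH] /=; first by move=> *; exists p; rewrite big_nil mul1r.
move=> /andP[xr ur] hb hp; have [||h E] := IH ur.
- by move=> i j hi hj; apply: hb; rewrite inE ?hi ?hj orbT.
- by move=> i hi; apply: hp; rewrite inE hi orbT.
have H := hp x (mem_head _ _); rewrite E in H.
have [|f Ef] := strip_prod _ H.
  move=> i q' hi; apply: divides_lin_same => //; apply: hb; rewrite ?inE ?eqxx ?hi ?orbT //.
  by apply: contraNneq xr => ->.
by exists f; rewrite big_cons E Ef; ring.
Qed.

(** * Bihomogeneous components *)

Definition bipart (d : nat * nat) p : R :=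
  \sum_(m <- msupp p | bideg m == d) p@_m *: 'X_[m].

Lemma mcoeff_bipart d p m : (bipart d p)@_m = if bideg m == d then p@_m else 0.
Proof.
rewrite raddf_sum /=.
have [hm|hm] := boolP (m \in msupp p); last first.
  rewrite big1_seq ?(memN_msupp_eq0 hm) ?if_same // => m' /andP[_ hm'].
  by rewrite mcoeffZ mcoeffX; case: eqP hm' hm => [->->|]; rewrite ?mulr0.
rewrite (big_rem m) //= big1_seq; last first.
  move=> m' /andP[_]; rewrite mem_rem_uniq ?msupp_uniq // !inE => /andP[ne _].
  by rewrite mcoeffZ mcoeffX (negPf ne) mulr0.
by case: eqP; rewrite ?addr0 // mcoeffZ mcoeffX eqxx mulr1.
Qed.

Lemma bipartD d p q : bipart d (p + q) = bipart d p + bipart d q.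
Proof.
by apply/mpolyP => m; rewrite mcoeffD !mcoeff_bipart mcoeffD; case: eqP; rewrite ?addr0.
Qed.

Lemma bipart0 d : bipart d 0 = 0.
Proof. by apply/mpolyP => m; rewrite !mcoeff_bipart !mcoeff0 if_same. Qed.

Lemma bipart_homog d p : bihomog p d -> bipart d p = p.
Proof.
move=> hp; apply/mpolyP => m; rewrite mcoeff_bipart; case: eqP => // hm.
have [//|h] := eqVneq p@_m 0; case: hm; apply: hp; by rewrite mcoeff_msupp.
Qed.

Lemma bihomog_bipart d p : bihomog (bipart d p) d.
Proof.
by move=> m; rewrite mcoeff_msupp mcoeff_bipart; have [//|_] := eqVneq (bideg m) d; rewrite eqxx.
Qed.

Definition addd (d e : nat * nat) := ((d.1 + e.1)%N, (d.2 + e.2)%N).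

Lemma adddC d e : addd d e = addd e d.
Proof. by rewrite /addd addnC [X in (_, X)]addnC. Qed.

Lemma adddA d e f : addd d (addd e f) = addd (addd d e) f.
Proof. by rewrite /addd /= !addnA. Qed.

Lemma bidegD m m' : bideg (m + m') = addd (bideg m) (bideg m').
Proof. by rewrite /bideg /addd /= !mnmDE; congr pair; lia. Qed.

Lemma bipartM d e g p : bihomog g e -> bipart (addd d e) (g * p) = g * bipart d p.
Proof.
move=> hg; rewrite [g in LHS]mpolyE [g in RHS]mpolyE !mulr_suml.
rewrite (big_morph (bipart _) (bipartD _) (bipart0 _)).
rewrite !big_seq; apply: eq_bigr => m /hg hm.
apply/mpolyP => m'; rewrite mcoeff_bipart -!scalerAl !mcoeffZ [_ * p]mulrC [_ * bipart d p]mulrC.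
have [hle|hle] := boolP (m <= m')%MM.
  rewrite -(submK hle) addmC !mcoeffMX mcoeff_bipart bidegD hm.
  have -> : (addd e (bideg (m' - m)) == addd d e) = (bideg (m' - m) == d).
    case: (bideg _) d e {hg hm} => [x y] [z t] [i j]; rewrite /addd !xpair_eqE /=.
    by rewrite ![(i + _)%N]addnC ![(j + _)%N]addnC !eqn_add2r.
  by case: eqP; rewrite ?mulr0.
have H q : (q * 'X_[m])@_m' = 0.
  apply: memN_msupp_eq0; rewrite (perm_mem (msuppMX _ _)); apply: contra hle.
  by move=> /mapP[x _ ->]; rewrite lem_addr.
by rewrite !H !mulr0 if_same.
Qed.

Lemma bipartM0 d e g p : bihomog g e -> (d.1 < e.1)%N || (d.2 < e.2)%N -> bipart d (g * p) = 0.
Proof.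
move=> hg hd; apply/mpolyP => m; rewrite mcoeff_bipart mcoeff0; case: eqP => // hm.
apply: memN_msupp_eq0; apply/negP => /msuppM_le /allpairsP[[x y] /= [/hg hx _ E]].
by move: hm hd; rewrite E bidegD hx => <-; rewrite /addd /=; lia.
Qed.

Lemma bihomogM d e p q : bihomog p d -> bihomog q e -> bihomog (p * q) (addd d e).
Proof.
by move=> hp hq m /msuppM_le /allpairsP[[x y] /= [/hp hx /hq hy ->]]; rewrite bidegD hx hy.
Qed.

Lemma bihomog1 : bihomog (1 : R) (0, 0)%N.
Proof.
by move=> m; rewrite msupp1 inE => /eqP->; rewrite /bideg !mnm0E.
Qed.

Definition sdeg s n : nat * nat := if s then (0, n)%N else (n, 0)%N.

Lemma addd_sdeg s m n : addd (sdeg s m) (sdeg s n) = sdeg s (m + n).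
Proof. by case: s. Qed.

Lemma bihomog_lin s a : bihomog (lin s a) (sdeg s 1).
Proof.
have bX i : bideg U_(var s i) = sdeg s 1.
  by rewrite /bideg !mnm1E; case: (s); case: i.
move=> m; rewrite mcoeff_msupp mcoeffB !mcoeffCM !mcoeffX.
have [<- _|_] := eqVneq U_(var s false)%MM m; first exact: bX.
have [<- _|_] := eqVneq U_(var s true)%MM m; first exact: bX.
by rewrite !mulr0 subr0 eqxx.
Qed.

Lemma bihomog_exp s p n : bihomog p (sdeg s 1) -> bihomog (p ^+ n) (sdeg s n).
Proof.
move=> hp; elim: n => [|n IH]; first by rewrite expr0; case: (s); apply: bihomog1.
by rewrite exprS -[n.+1]add1n -addd_sdeg; apply: bihomogM.
Qed.

Lemma bihomog_prod s (T : Type) (r : seq T) (b : T -> k * k) (n : T -> nat) :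
  bihomog (\prod_(i <- r) lin s (b i) ^+ n i) (sdeg s (\sum_(i <- r) n i)).
Proof.
elim: r => [|x r IH]; first by rewrite !big_nil; case: (s); apply: bihomog1.
by rewrite !big_cons -addd_sdeg; apply: bihomogM => //; apply/bihomog_exp/bihomog_lin.
Qed.

Lemma powI_bipart s a b n d p :
  powI (lin s a) (lin (~~ s) b) n p -> powI (lin s a) (lin (~~ s) b) n (bipart d p).
Proof.
elim: n d p => [//|n IH] d p [u [v [hu hv ->]]]; rewrite bipartD.
(* Taking a component passes through a linear factor at the cost of lowering the bidegree; if the
   bidegree is too small, the component is 0. *)
have key s' c q : (forall d, powI (lin s a) (lin (~~ s) b) n (bipart d q)) ->
    exists2 q', powI (lin s a) (lin (~~ s) b) n q' & bipart d (lin s' c * q) = lin s' c * q'.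
  move=> hq; have hl := @bihomog_lin s' c.
  have [h|h] := boolP ((d.1 < (sdeg s' 1).1)%N || (d.2 < (sdeg s' 1).2)%N).
    exists 0; first exact: ideal_zero (powI_ideal _ _ _).
    by rewrite mulr0 (bipartM0 _ hl h).
  exists (bipart (d.1 - (sdeg s' 1).1, d.2 - (sdeg s' 1).2)%N q) => //.
  rewrite -(bipartM _ _ hl); congr bipart.
  by case: (d) h => x y; rewrite /addd /=; case: (s') => /= h; congr pair; lia.
have [u' hu' ->] := key s a u (fun d => IH d _ hu).
have [v' hv' ->] := key (~~ s) b v (fun d => IH d _ hv).
by exists u', v'.
Qed.

End LinearForms.

(** * Depth and dimension *)

Section Depth.
Variable k : closedFieldType.
Local Notation R := {mpoly k[4]}.
Implicit Types (I J : R -> Prop) (p q u v w f l : R).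

Definition rad I p := exists n, I (p ^+ n).

Lemma rad_ideal I : is_ideal I -> is_ideal (rad I).
Proof.
move=> hI; split; first by exists 1%N; rewrite expr1; apply: ideal_zero.
split=> [p q [a ha] [b hb]|p q [a ha]]; last by exists a; rewrite exprMn; apply: ideal_mull.
exists (a + b)%N; rewrite exprDn; apply: ideal_sum => // i _.
rewrite -mulr_natl; apply: ideal_mull => //.
have [hi|hi] := leqP b i.
  by rewrite -(subnK hi) [q ^+ _]exprD; do 2!apply: ideal_mull => //.
have -> : (a + b - i = (b - i) + a)%N by lia.
by rewrite exprD; apply: ideal_mulr => //; apply: ideal_mull.
Qed.

(** Powers of a regular sequence are again regular. In the induction on N, a is first written as z +
    f1 b modulo I; one factor f1 is then cancelled from the relation, leaving the same relation for
    b with exponent N. *)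
Lemma regular_pow I f1 f2 N M : is_ideal I -> (forall a, I (a * f1) -> I a) ->
  (forall a, addI I f1 (a * f2) -> addI I f1 a) ->
  forall a, addI I (f1 ^+ N) (a * f2 ^+ M) -> addI I (f1 ^+ N) a.
Proof.
move=> hI h1 h2; have h2M a : addI I f1 (a * f2 ^+ M) -> addI I f1 a.
  by elim: M a => [|M IH] a; rewrite ?mulr1 // exprSr mulrA => /h2/IH.
elim: N => [|N IH] a; first by move=> _; exists 0, a; split; [apply: ideal_zero|ring].
case=> x [y [hx E]]; have [|z [b [hz Ea]]] := h2M a.
  by exists x, (f1 ^+ N * y); split; rewrite // E exprS; ring.
have [|z' [b' [hz' Eb]]] := IH b.
  exists (b * f2 ^+ M - f1 ^+ N * y), y; split; last by ring.
  apply: h1; suff -> : (b * f2 ^+ M - f1 ^+ N * y) * f1 = x - f2 ^+ M * z.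
    by apply: ideal_subr => //; apply: ideal_mull.
  have -> : x = a * f2 ^+ M - f1 ^+ N.+1 * y by rewrite E; ring.
  by rewrite Ea exprS; ring.
exists (z + f1 * z'), b'; split; last by rewrite Ea Eb exprS; ring.
by apply: ideal_addr => //; apply: ideal_mull.
Qed.

(* The pair (p, q) with l q = l' p mod I is a section s = p / l = q / l' of R / I off
   the zero set of (l, l'); multiplying s by powers of f1 and f2 gives elements of R / I,
   and regularity of (f1, f2) lets s itself be lifted. *)
Lemma depth2_sat I f1 f2 l l' p : is_ideal I -> (forall a, I (a * f1) -> I a) ->
  (forall a, addI I f1 (a * f2) -> addI I f1 a) -> (forall a, I (l * a) -> I a) ->
  rad (addI (addI I l) l') f1 -> rad (addI (addI I l) l') f2 ->
  addI I l (l' * p) -> addI I l p.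
Proof.
move=> hI h1 h2 hl [N hN] [M hM] [i [q [hi E]]].
have lift f : addI (addI I l) l' f -> exists P, I (l * P - f * p).
  case=> _ [b [[j [a [hj ->]]] ->]]; exists (a * p + b * q).
  have -> : l * (a * p + b * q) - (j + l * a + l' * b) * p = - (j * p) - b * i.
    have -> : i = l' * p - l * q by rewrite E; ring.
    by ring.
  by apply: ideal_subr => //; [apply: ideal_oppr => //; apply: ideal_mulr | apply: ideal_mull].
have [P hP] := lift _ hN; have [Q hQ] := lift _ hM.
have [|z [h [hz EP]]] := regular_pow (N := N) (M := M) hI h1 h2 (a := P).
  exists (P * f2 ^+ M - f1 ^+ N * Q), Q; split; last by ring.
  apply: hl.
  have -> : l * (P * f2 ^+ M - f1 ^+ N * Q) =
    f2 ^+ M * (l * P - f1 ^+ N * p) - f1 ^+ N * (l * Q - f2 ^+ M * p) by ring.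
  by apply: ideal_subr => //; apply: ideal_mull.
exists (p - l * h), h; split; last by ring.
have : I (f1 ^+ N * (p - l * h)).
  have -> : f1 ^+ N * (p - l * h) = l * z - (l * P - f1 ^+ N * p) by rewrite EP; ring.
  by apply: ideal_subr => //; apply: ideal_mull.
by apply: strip_exp => a; rewrite mulrC; apply: h1.
Qed.

(** The variables outside [A] are sent to 0, so the kernel is the prime ideal they generate.
    Describing that prime as a kernel reduces primality to R being a domain. *)
Definition kill (A : pred 'I_4) : R -> R := comp_mpoly [tuple (if A i then 'X_i else 0) | i < 4].
HB.instance Definition _ (A : pred 'I_4) := GRing.RMorphism.on (kill A).

Lemma killX (A : pred 'I_4) i : kill A 'X_i = if A i then 'X_i else 0.
Proof. by rewrite /kill comp_mpolyXU -tnth_nth tnth_mktuple. Qed.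

Lemma kill_kill (A B : pred 'I_4) p : subpred A B -> kill A (kill B p) = kill A p.
Proof.
move=> AB; apply: (@mpoly_morph_eq k (kill A \o kill B) (kill A)) => [x|i] /=.
  by rewrite /kill !comp_mpolyC.
rewrite !killX; case: (boolP (B i)) => [_|nB]; first by rewrite killX.
by rewrite rmorph0; case: (boolP (A i)) => // /AB; rewrite (negPf nB).
Qed.

Section Primes.
Variable Phi : {rmorphism R -> R}.
Hypothesis bijPhi : bijective Phi.

Definition vprime (A : pred 'I_4) p := exists2 q, p = Phi q & kill A q = 0.

Lemma vprime_prime A : is_prime (vprime A).
Proof.
have inj := bij_inj bijPhi; case: bijPhi => Psi PhiK PsiK; split.
  split; first by exists 0; rewrite rmorph0.
  split=> [_ _ [p -> hp] [q -> hq]|a _ [p -> hp]].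
    by exists (p + q); rewrite rmorphD //= hp hq addr0.
  by exists (Psi a * p); rewrite rmorphM ?PsiK //= hp mulr0.
split=> [[q]|a b [q]].
  rewrite -(rmorph1 Phi) => /inj <-; rewrite rmorph1 => /eqP; by rewrite oner_eq0.
rewrite -[a]PsiK -[b]PsiK -rmorphM => /inj <-; rewrite rmorphM => /eqP.
rewrite mulf_eq0 => /orP[] /eqP h; [left|right]; by [exists (Psi a)|exists (Psi b)].
Qed.

Lemma vprime_sub (A B : pred 'I_4) p : subpred A B -> vprime B p -> vprime A p.
Proof.
by move=> AB [q -> hq]; exists q => //; rewrite -(kill_kill q AB) hq rmorph0.
Qed.

Lemma vprimeX (A : pred 'I_4) i : vprime A (Phi 'X_i) <-> ~~ A i.
Proof.
split=> [[q /(bij_inj bijPhi) <-]|nA]; last by exists 'X_i; rewrite // killX (negPf nA).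
rewrite killX; case: ifP => // _ /mpolyP /(_ U_(i)%MM).
by rewrite mcoeffX eqxx mcoeff0 => /eqP; rewrite oner_eq0.
Qed.
End Primes.

End Depth.

(** * Generic forms and regular sequences on the quotient by I_Z *)

Section Points.
Variables (k : closedFieldType) (r t : nat).
Variables (Rp : 'I_r -> k * k) (Qp : 'I_t -> k * k) (mu : 'I_r -> 'I_t -> nat).
Local Notation R := {mpoly k[4]}.

Lemma generic_point n (P : 'I_n -> k * k) : (forall i, P1pt (P i)) ->
  exists2 c, P1pt c & forall i, P1_distinct (P i) c.
Proof.
move=> hP; pose Q : {poly k} := \prod_i ((P i).1 *: 'X - (P i).2%:P).
have Q0 : Q != 0.
  apply/prodf_neq0 => i _; have := hP i; rewrite /P1pt; apply: contraNneq => E.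
  have := congr1 (fun q : {poly k} => q`_0) E; have := congr1 (fun q : {poly k} => q`_1) E.
  rewrite !coefB !coefZ !coefX !coefC /= mulr1 mulr0 subr0 sub0r.
  by case: (P i) => x y /= -> /eqP; rewrite oppr_eq0 => /eqP ->.
(* A root z of X Q + 1 cannot be a root of Q, so [1 : z] avoids all the given points. *)
have /closed_rootP[z] : size ('X * Q + 1) != 1%N.
  rewrite size_addl ?size_poly1 mulrC size_mulX //; first by rewrite eqSS size_poly_eq0.
  by rewrite ltnS lt0n size_poly_eq0.
rewrite rootE hornerD hornerM hornerX hornerC horner_prod => zQ.
exists (1, z); first by rewrite /P1pt xpair_eqE oner_eq0.
move=> i; apply/negP => /eqP /= E; move: zQ; rewrite (bigD1 i) //=.
by rewrite hornerD hornerN hornerZ hornerX hornerC E mulr1 subrr mul0r mulr0 add0r oner_eq0.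
Qed.

Local Notation I := (IZ Rp Qp mu).
Local Notation L i := (lin false (Rp i)).
Local Notation V j := (lin true (Qp j)).

Lemma IZP p : I p <-> forall i j, powI (L i) (V j) (mu i j) p.
Proof. by split=> h i j; [apply/ideal_powP/h | apply/ideal_powP/h]. Qed.

Lemma IZ_ideal : is_ideal I.
Proof.
split; first by apply/IZP => i j; apply: ideal_zero; apply: powI_ideal.
split=> [a b /IZP ha /IZP hb|a b /IZP hb]; apply/IZP => i j.
  by apply: ideal_addr => //; apply: powI_ideal.
by apply: ideal_mull => //; apply: powI_ideal.
Qed.

Hypothesis hRpt : forall i, P1pt (Rp i).
Hypothesis hQpt : forall j, P1pt (Qp j).

Lemma IZ_prime_chain i j : (0 < mu i j)%N -> exists P, prime_chain I 2 P.
Proof.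
move=> mu0; have [a ha] := P1_complement (hRpt i); have [b hb] := P1_complement (hQpt j).
have [Phi bPhi [E0 E1 E2 E3]] := lin_coords false ha hb.
(* [A n] holds the variables that survive: x1 and y1, then y1, then none. In coordinates with L_i =
   x0 and V_j = y0 the chain is (x0, y0), (x0, x1, y0), (x0, x1, y0, y1). *)
pose A n : pred 'I_4 := fun l : 'I_4 =>
  [&& l == 1%N :> nat & n == 0%N] || [&& l == 3%N :> nat & (n < 2)%N].
exists (fun n => vprime Phi (A n)); split=> n hn.
  split; first exact: vprime_prime.
  move=> p /IZP /(_ i j); case: (mu i j) mu0 => // m _ [c [d [_ _ ->]]].
  have [hI _] := vprime_prime bPhi (A n).
  by apply: ideal_addr => //; apply: ideal_mulr => //; rewrite -?E0 -?E2; apply/vprimeX.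
split; first by move=> p; apply: vprime_sub => l; rewrite /A; case/orP => /andP[]; lia.
exists (Phi 'X_(if n is 0%N then i1 else i3)); split; first by apply/vprimeX; case: n hn => [|[]].
by move/vprimeX => /(_ bPhi); case: n hn => [|[]].
Qed.

(** The chain of primes over I gives dimension at least 2. Depth equals dimension, so some regular
    sequence has at least two terms, and its first two serve. *)
Lemma CM_regular i j : (0 < mu i j)%N -> CohenMacaulay_quot I ->
  exists f1 f2, [/\ irrelevant f1, irrelevant f2, forall a, I (a * f1) -> I a &
    forall a, addI I f1 (a * f2) -> addI I f1 a].
Proof.
move=> mu0 [n [[_ hdim] [[fs [szf [hirr [hreg _]]]] _]]].
have [P hP] := IZ_prime_chain mu0; have := hdim _ _ hP; rewrite -szf => sz2.
case: fs hirr hreg sz2 {szf} => [|f1 [|f2 fs]] // hirr hreg _.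
exists f1, f2; split; try by apply: hirr; rewrite !inE eqxx ?orbT.
- move=> a ha; have [|x [y [hx [[rs [_ ->]] ->]]]] := hreg 0%N isT a.
    exists (a * f1), 0; split=> //; split; last by rewrite addr0.
    by exists [::]; rewrite big_ord0.
  by rewrite big_ord0 addr0.
- move=> a [x [y [hx E]]]; have [|x' [y' [hx' [[rs [_ Ey]] ->]]]] := hreg 1%N isT a.
    exists x, (f1 * y); split=> //; split; last by [].
    by exists [:: y]; rewrite /= big_ord1 /= mulrC.
  by exists x', rs`_0; split; rewrite // Ey big_ord1 /= mulrC.
Qed.

(** Modulo [lin s c], each [lin s x] is a scalar multiple of [lin s (P i)], because the point [P i]
    differs from c. The factors can therefore be exchanged one by one. *)
Lemma lin_transfer (J : R -> Prop) s n (P : 'I_n -> k * k) (N : 'I_n -> nat) c x q :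
  is_ideal J -> (forall i, P1_distinct (P i) c) -> J (lin s c) ->
  J ((\prod_i lin s (P i) ^+ N i) * q) -> J (lin s x ^+ (\sum_i N i) * q).
Proof.
move=> hJ hc Jc; have step i p : J (lin s (P i) * p) -> J (lin s x * p).
  have [a [b ->]] := lin_span s x (hc i) => h; rewrite mulrDl -!mulrA.
  apply: ideal_addr => //; apply: ideal_mull => //; exact: ideal_mulr.
elim: (index_enum _) q => [|i e IH] q; first by rewrite !big_nil.
rewrite !big_cons exprD -!mulrA; elim: (N i) q => [|m IHm] q; first by rewrite !mul1r => /IH.
rewrite !exprS -!mulrA => /step; rewrite mulrCA [lin s x * (_ * q)]mulrCA => /IHm.
by rewrite [_ ^+ (\sum_(j <- e) N j) * (lin s x * q)]mulrCA [_ ^+ m * (lin s x * _)]mulrCA.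
Qed.

Lemma IZ_prod_rows : I (\prod_i L i ^+ (\sum_j mu i j)).
Proof.
apply/IZP => i j; rewrite (bigD1 i) //=; apply: ideal_mulr; first exact: powI_ideal.
rewrite -[_ ^+ _]mulr1 -(expr0 (V j)); apply: powI_exp.
by rewrite addn0 (bigD1 j) //= leq_addr.
Qed.

Lemma IZ_prod_cols : I (\prod_j V j ^+ (\sum_i mu i j)).
Proof.
apply/IZP => i j; rewrite (bigD1 j) //=; apply: ideal_mulr; first exact: powI_ideal.
rewrite -[_ ^+ _]mul1r -(expr0 (L i)); apply: powI_exp.
by rewrite add0n (bigD1 i) //= leq_addr.
Qed.

(** I_Z contains a product of row forms and a product of column forms. Modulo the two generic forms
    these become powers of an arbitrary linear form in x or in y, so every variable is nilpotent. *)
Lemma irrelevant_rad c c' f : (forall i, P1_distinct (Rp i) c) -> (forall j, P1_distinct (Qp j) c') ->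
  irrelevant f -> rad (addI (addI I (lin false c)) (lin true c')) f.
Proof.
move=> hc hc' [rs [_ ->]]; set J := addI _ _.
have hI1 := addI_ideal (lin false c) IZ_ideal.
have hJ : is_ideal J by apply: addI_ideal.
have hx s x : rad J (lin s x).
  have [N hN] : exists N, J (lin s x ^+ N * 1).
    case: s; eexists; [apply: (lin_transfer _ (P := Qp) (c := c')) | apply: (lin_transfer _ (P := Rp) (c := c))] => //.
    - exact: addI_gen.
    - by do 2!apply: addI_sub; rewrite mulr1; apply: IZ_prod_cols.
    - by apply: addI_sub; apply: addI_gen; apply: IZ_ideal.
    - by do 2!apply: addI_sub; rewrite mulr1; apply: IZ_prod_rows.
  by exists N; rewrite mulr1 in hN.
have hX i : rad J 'X_i by have [s [b ->]] := ord4_var i; rewrite varE.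
apply: ideal_sum; first exact: rad_ideal.
case=> -[|[|[|[|//]]]] hi _; apply: ideal_mull; try exact: rad_ideal; exact: hX.
Qed.

End Points.

(** * Total order of the truncated rows *)

Section TotalOrder.
Variables (k : closedFieldType) (r t : nat).
Variables (Rp : 'I_r -> k * k) (Qp : 'I_t -> k * k) (mu : 'I_r -> 'I_t -> nat).
Local Notation R := {mpoly k[4]}.
Local Notation I := (IZ Rp Qp mu).
Local Notation L i := (lin false (Rp i)).
Local Notation V j := (lin true (Qp j)).
Hypothesis hRpt : forall i, P1pt (Rp i).
Hypothesis hQpt : forall j, P1pt (Qp j).
Hypothesis hRd : forall i i', i != i' -> P1_distinct (Rp i) (Rp i').
Hypothesis hQd : forall j j', j != j' -> P1_distinct (Qp j) (Qp j').

(** Local membership implies global membership: the products omitting one point have no common zero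
    on the line, and K is saturated with respect to [lin s c]. *)
Lemma ideal_sat_unit (K : R -> Prop) s c (e : seq 'I_t) (N : 'I_t -> nat) w :
  is_ideal K -> (forall p, K (lin s c * p) -> K p) -> uniq e -> e != [::] ->
  (forall j, j \in e -> K ((\prod_(j' <- e | j' != j) lin s (Qp j') ^+ N j') * w)) -> K w.
Proof.
move=> hK hc.
(* [lin s c] is a combination of the forms at j and j', so it multiplies V_j^(n-1) p into K and can
   be cancelled; n then descends. *)
have two j j' n p : j != j' -> K (lin s (Qp j) ^+ n * p) -> K (lin s (Qp j') * p) -> K p.
  move=> jj'; elim: n p => [|n IH] p; first by rewrite mul1r.
  move=> h1 h2; apply: IH => //; apply: hc.
  have [x [y ->]] := lin_span s c (hQd jj'); rewrite mulrDl -!mulrA.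
  apply: ideal_addr => //; apply: ideal_mull => //; first by rewrite mulrA -exprS.
  by rewrite mulrCA; apply: ideal_mull.
have twopow j j' n m p : j != j' -> K (lin s (Qp j) ^+ n * p) ->
    K (lin s (Qp j') ^+ m * p) -> K p.
  move=> jj' hj; elim: m => [|m IH]; first by rewrite mul1r.
  rewrite exprS -mulrA => h; apply/IH/(two _ _ n _ jj') => //.
  by rewrite mulrCA; apply: ideal_mull.
have many j n (f : seq 'I_t) p : j \notin f -> K (lin s (Qp j) ^+ n * p) ->
    K ((\prod_(j' <- f) lin s (Qp j') ^+ N j') * p) -> K p.
  elim: f => [|x f IH]; first by rewrite big_nil mul1r.
  rewrite inE negb_or big_cons -mulrA => /andP[jx jf] hj h.
  apply: IH => //; apply: (twopow _ _ n _ _ jx _ h).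
  by rewrite mulrCA; apply: ideal_mull.
elim: e w => [//|j0 e IH] w /andP[j0e ue] _ h.
have h0 : K ((\prod_(j' <- e) lin s (Qp j') ^+ N j') * w).
  have := h j0 (mem_head _ _); rewrite big_cons eqxx /= big_seq_cond.
  rewrite [in X in _ -> X]big_seq (eq_bigl (fun j => j \in e)) // => j.
  by rewrite andb_idr // => je; apply: contraNneq j0e => <-.
case: e => [|j1 e] in IH h h0 j0e ue *; first by rewrite big_nil mul1r in h0.
(* The hypothesis at [j0] puts the product over the other points times w into K; the induction
   hypothesis, applied to V_j0^(N j0) w, supplies the complementary membership. *)
apply: (many j0 (N j0) _ _ j0e _ h0); apply: IH => // j je.
have := h j; rewrite inE je orbT big_cons => /(_ isT).
have -> : j0 != j by apply: contraNneq j0e => ->.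
by rewrite [lin s (Qp j0) ^+ _ * _]mulrC -mulrA.
Qed.

Lemma bipart_divides d e (g p : R) : bihomog g e -> divides g p -> divides g (bipart d p).
Proof.
move=> hg [h ->]; have [hd|hd] := boolP ((d.1 < e.1)%N || (d.2 < e.2)%N).
  by exists 0; rewrite mulr0 (bipartM0 _ hg hd).
exists (bipart (d.1 - e.1, d.2 - e.2)%N h); rewrite -(bipartM _ _ hg); congr bipart.
by case: (d) (e) hd => [x y] [z u]; rewrite /addd /= => hd; congr pair; lia.
Qed.

Lemma IZ_bipart d p : I p -> I (bipart d p).
Proof. by move=> /IZP h; apply/IZP => i j; apply: (@powI_bipart k false). Qed.

(** The forms of the other columns are nonzerodivisors modulo the power, while each factor V_j uses
    up one unit of the exponent. *)
Lemma powI_strip_cols i j (N : 'I_t -> nat) p n :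
  powI (L i) (V j) n ((\prod_j V j ^+ N j) * p) -> powI (L i) (V j) (n - N j) p.
Proof.
rewrite (bigD1 j) //= -mulrA mulrCA big_mkcond => h.
have {}h : powI (L i) (V j) n (V j ^+ N j * p).
  apply: (@strip_prod _ (powI (L i) (V j) n) _ (index_enum 'I_t)
    (fun l => if l != j then V l else 1) N _ _); last first.
    suff <- : \prod_l (if l != j then V l ^+ N l else 1) =
      \prod_l (if l != j then V l else 1) ^+ N l by [].
    by apply: eq_bigr => l _; case: ifP; rewrite ?expr1n.
  move=> l q _; case: ifP => lj; last by rewrite mul1r.
  move=> {}h; apply: powIC; apply: (@powI_lin_other _ true _ (Qp l)); rewrite /= ?hRpt //.
    by apply: hQd; rewrite eq_sym.
  exact: powIC.
elim: (N j) n h => [|m IH] n; first by rewrite mul1r subn0.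
case: n => [//|n]; rewrite subSS exprS -mulrA => h; apply: IH.
by apply: powIC; apply: (powI_lin_same (s := true) (hQpt j) (hRpt i)); apply: powIC.
Qed.

(** If G = V_j^e h, then modulo V_j the cofactor h is a multiple of the product of the L_i^(mu_ij -
    e). That product has x-degree above d, so it contributes nothing to G and one more V_j divides
    G. *)
Lemma divides_col d j e (G : R) D : I G -> bihomog G (d, D) ->
  (forall f, (f < e)%N -> (d < \sum_i (mu i j - f))%N) -> divides (V j ^+ e) G.
Proof.
move=> /IZP hG hd; elim: e => [|e IH] he; first by exists G; rewrite mul1r.
have [h Eh] := IH (fun f fe => he f (ltnW fe)).
have [|q [q' E]] := @powI_mod_prod k true (Qp j) _ (index_enum 'I_r) Rp (fun i => mu i j - e)%N h
  (index_enum_uniq _) (hQpt j) (fun i i' _ _ => @hRd i i').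
  move=> i _; apply: powIC; have := hG i j; rewrite Eh.
  have -> : V j ^+ e = \prod_l V l ^+ (if l == j then e else 0%N).
    by rewrite (bigD1 j) //= eqxx big1 ?mulr1 // => l /negPf->.
  by move=> /powI_strip_cols; rewrite eqxx.
rewrite /= in E.
have := bipart_homog hd; rewrite {1}Eh E mulrDr !mulrA -exprSr bipartD.
rewrite [X in _ + X](bipartM0 (e := (\sum_i (mu i j - e), e))%N); last 2 first.
- have := bihomogM (@bihomog_exp _ true _ e (@bihomog_lin k true (Qp j)))
    (@bihomog_prod k false _ (index_enum 'I_r) Rp (fun i => mu i j - e)%N).
  by rewrite /addd /= add0n addn0.
- by rewrite /= he.
rewrite addr0 => <-; apply: (@bipart_divides _ (sdeg true e.+1)); last by exists q.
exact/bihomog_exp/bihomog_lin.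
Qed.

Lemma lin_not_divides s (a : k * k) : ~ divides (lin s a) 1.
Proof.
case=> h /(congr1 (bipart (0, 0)%N)); rewrite (bipart_homog (@bihomog1 k)).
rewrite (bipartM0 _ (@bihomog_lin k s a)); last by case: s.
by move/eqP; rewrite oner_eq0.
Qed.

(* With F = prod_j V_j^(e j), the product x^d F lies in I + (l) locally at each Q_j, and
   regularity of (l, l') makes this membership global; G below is the lift of x^d F to I. *)
Lemma CM_row_bound (j0 : 'I_t) d (e : 'I_t -> nat) i0 : (0 < mu i0 j0)%N -> CohenMacaulay_quot I ->
  (forall j, (\sum_i (mu i j - e j) <= d)%N) ->
  (forall j f, (f < e j)%N -> (d < \sum_i (mu i j - f))%N) ->
  (\sum_i \max_j (mu i j - e j) <= d)%N.
Proof.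
move=> mu0 hCM he emin; have hI := IZ_ideal Rp Qp mu.
have [f1 [f2 [irr1 irr2 reg1 reg2]]] := CM_regular hRpt hQpt mu0 hCM.
have [c hc Rc] := generic_point hRpt; have [c' hc' Qc'] := generic_point hQpt.
have [x cx] := P1_complement hc.
pose l := lin false c; pose l' := lin true c'; pose J := addI I l.
have hJ : is_ideal J by apply: addI_ideal.
(* Depth two enters here: l' is a nonzerodivisor modulo I + (l), since the radical of I + (l, l')
   contains f1 and f2. *)
have Jsat p : J (l' * p) -> J p.
  apply: (depth2_sat hI reg1 reg2); try exact: irrelevant_rad.
  move=> a /IZP h; apply/IZP => i j.
  exact: (powI_lin_other (s := false) (Rc i) (hQpt j)).
(* [N j] is at least every multiplicity in column j, so V_j^(N j) meets all conditions of that
   column. *)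
pose F := \prod_j V j ^+ e j; pose N j := (\sum_i mu i j)%N.
have JF : J (lin false x ^+ d * F).
  rewrite -[_ * F]mulr1.
  apply: (ideal_sat_unit (colon_ideal (lin false x ^+ d * F) hJ) (s := true) (c := c')
    (e := index_enum 'I_t) (N := N)) => //.
  - by move=> p; rewrite mulrCA => /Jsat.
  - exact: index_enum_uniq.
  - by have := mem_index_enum j0; case: (index_enum _).
  move=> j _; rewrite mulr1; set W := \prod_(j' <- _ | _) _.
  (* Modulo l, part of the power is traded for the row forms L_i^(mu_ij - e_j); the bound on the
     column sums ensures that d factors are enough. *)
  have -> : lin false x ^+ d = lin false x ^+ (d - \sum_i (mu i j - e j)) *
      lin false x ^+ (\sum_i (mu i j - e j)) by rewrite -exprD subnK.
  rewrite -!mulrA; apply: ideal_mull => //.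
  apply: (lin_transfer (P := Rp) (c := c)) => //; first exact: addI_gen.
  (* In column j the row forms together with V_j^(e_j) reach the exponent mu_ij; in any other column
     the factor from [W] already does. *)
  apply: addI_sub; apply/IZP => i j'; have [->|nj] := eqVneq j' j.
    rewrite (bigD1 i) //= /F (bigD1 j) //=.
    set A := \prod_(i0 < r | _) _; set B := \prod_(j' < t | _) _.
    rewrite (_ : _ * _ = (L i ^+ (mu i j - e j) * V j ^+ e j) * (A * B * W)); last by ring.
    apply: ideal_mulr; first exact: powI_ideal.
    by apply: powI_exp; lia.
  rewrite mulrA /W (bigD1 j') //= mulrCA; apply: ideal_mulr; first exact: powI_ideal.
  rewrite -[_ ^+ _]mul1r -(expr0 (L i)); apply: powI_exp.
  by rewrite add0n /N (bigD1 i) //= leq_addr.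
have [G0 [b [IG0 E]]] := JF.
pose D := (d, \sum_j e j)%N; pose G := bipart D G0.
have IG : I G by apply: IZ_bipart.
have hG : bihomog G (d, \sum_j e j)%N by apply: bihomog_bipart.
have hF : bihomog F (0, \sum_j e j)%N by apply: (@bihomog_prod k true).
(* If G were 0, then l would divide x^d F; cancelling the factors of this product, all coprime to l,
   would make l divide 1. *)
have G0' : G != 0.
  apply/eqP => G00; apply: (@lin_not_divides false c).
  have : divides l (lin false x ^+ d * F).
    rewrite -[_ * F](bipart_homog (d := D)).
      rewrite E bipartD -/G G00 add0r; apply: (@bipart_divides _ _ _ _ (@bihomog_lin k false c)).
      by exists b.
    have := bihomogM (@bihomog_exp _ false _ d (@bihomog_lin k false x)) hF.
    by rewrite /addd /= add0n addn0.
  move=> /(@strip_exp _ (divides l)) h.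
  have {}h : divides l (F * 1).
    rewrite mulr1; apply: h => q; rewrite -[l]expr1; apply: divides_lin_same => //.
  move: h; apply: strip_prod => j q _.
  exact: (divides_lin_other (s := false)).
have [H0 EH0] : divides F G.
  apply: (divides_prod (s := true)) => [|j j' _ _|j _]; first exact: index_enum_uniq.
    exact: hQd.
  exact: (divides_col IG hG (emin j)).
(* Since G and F are bihomogeneous, the cofactor can be replaced by its component of bidegree (d,
   0). *)
pose H := bipart (d, 0)%N H0.
have EH : G = F * H.
  by rewrite -(bipartM _ _ hF) -EH0 /addd /= addn0 add0n bipart_homog.
have hH : bihomog H (d, 0)%N by apply: bihomog_bipart.
(* H has y-degree 0, so the summand divisible by V_j drops out and only the multiple of the power of
   L_i remains. *)
have LH i j : divides (L i ^+ (mu i j - e j)) H.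
  have /IZP /(_ i j) := IG; rewrite EH => /powI_strip_cols /powIC /powI_mod [u [v Euv]].
  rewrite -(bipart_homog hH) Euv bipartD (bipartM0 _ (@bihomog_lin k true (Qp j))) // add0r.
  apply: bipart_divides; last by exists v.
  exact/(@bihomog_exp _ false)/bihomog_lin.
have [w Ew] : divides (\prod_i L i ^+ (\max_j (mu i j - e j))) H.
  apply: (divides_prod (s := false)) => [|i i' _ _|i _]; first exact: index_enum_uniq.
    exact: hRd.
  have [|j ->] := @bigop.eq_bigmax _ (fun j => mu i j - e j)%N; last exact: LH.
  by apply/card_gt0P; exists j0.
(* A product of row powers of x-degree above d has no nonzero multiple of x-degree d, which would
   force H and G to vanish. *)
rewrite leqNgt; apply/negP => lt_d; case/eqP: G0'.
rewrite EH -(bipart_homog hH) Ew.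
rewrite (bipartM0 _ (@bihomog_prod k false _ (index_enum 'I_r) Rp (fun i => \max_j (mu i j - e j))%N)).
  by rewrite mulr0.
by rewrite /= lt_d.
Qed.

Lemma CM_total_order i0 i1 a b : CohenMacaulay_quot I ->
  (forall j, (mu i0 j - a <= mu i1 j - b)%N) \/ (forall j, (mu i1 j - b <= mu i0 j - a)%N).
Proof.
move=> hCM.
have exP d j : exists e, (\sum_i (mu i j - e) <= d)%N.
  exists (\sum_i mu i j)%N; rewrite big1 // => i _; apply/eqP; rewrite subn_eq0.
  by rewrite (bigD1 i) //= leq_addr.
(* The exponent of V_j in the form F_d: the least cut of column j that leaves a sum of at most d.
   The maxima [g d i] over the cut columns increase with d. *)
pose e d j := ex_minn (exP d j).
have eP d j : (\sum_i (mu i j - e d j) <= d)%N by rewrite /e; case: ex_minnP.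
have emin d j f : (\sum_i (mu i j - f) <= d)%N -> (e d j <= f)%N.
  by rewrite /e; case: ex_minnP => m _ h; apply: h.
have emono d d' j : (d <= d')%N -> (e d' j <= e d j)%N.
  by move=> dd'; apply: emin; apply: leq_trans dd'.
pose g d i := \max_j (mu i j - e d j).
have gmono d d' i : (d <= d')%N -> (g d i <= g d' i)%N.
  move=> dd'; apply/bigmax_leqP => j _; apply: leq_trans (leq_bigmax j).
  by apply: leq_sub2l; apply: emono.
(* For d the sum of column j cut at v, each [g d i'] is at least mu_i'j - v, while the row bound
   limits their sum to d; all the inequalities are equalities. Every such cut column thus belongs to
   the monotone family g. *)
have gE j v i : (0 < mu i j)%N -> forall i', g (\sum_i (mu i j - v))%N i' = (mu i' j - v)%N.
  move=> mu0; set d := (\sum_i _)%N.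
  have hle i' : (mu i' j - v <= g d i')%N.
    by apply: leq_trans (leq_bigmax j); apply: leq_sub2l; apply: emin.
  have hsum : (\sum_i g d i <= d)%N.
    apply: (CM_row_bound mu0 hCM (eP d)) => j' f; rewrite !ltnNge; apply: contra; exact: emin.
  have hs : (\sum_i g d i == \sum_i (mu i j - v))%N by rewrite eqn_leq hsum leq_sum.
  move=> i'; apply/eqP; rewrite eqn_leq hle andbT leqNgt; apply/negP => lt.
  have : (\sum_i (mu i j - v) < \sum_i g d i)%N.
    by rewrite (bigD1 i') //= [X in (_ < X)%N](bigD1 i') //= -addSn leq_add // leq_sum.
  by rewrite (eqP hs) ltnn.
have [/forallP|/forallPn[j]] := boolP [forall j, mu i0 j - a <= mu i1 j - b]%N; first by left.
have [/forallP|/forallPn[j']] := boolP [forall j, mu i1 j - b <= mu i0 j - a]%N; first by right.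
rewrite -!ltnNge => hj' hj; exfalso.
(* With these cuts, column j exceeds a at [i0] and is at most b at [i1], while column j' exceeds b
   at [i1] and is at most a at [i0]. A family monotone in d cannot contain both. *)
pose d := (\sum_i (mu i j - (mu i1 j - b)))%N; pose d' := (\sum_i (mu i j' - (mu i0 j' - a)))%N.
have gd := @gE j (mu i1 j - b)%N i0 ltac:(lia).
have gd' := @gE j' (mu i0 j' - a)%N i1 ltac:(lia).
have [dd'|/ltnW dd'] := leqP d d'.
  by have := gmono _ _ i0 dd'; rewrite gd gd'; lia.
by have := gmono _ _ i1 dd'; rewrite gd gd'; lia.
Qed.

End TotalOrder.

(** * Resolutions indexed by finite types *)

Lemma enum_option (A : finType) : enum {: option A} = None :: map Some (enum A).
Proof. by rewrite !enumT [in LHS]unlock. Qed.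

Lemma big_option (W : Type) (idx : W) (op : Monoid.com_law idx) (A : finType) (F : option A -> W) :
  \big[op/idx]_a F a = op (F None) (\big[op/idx]_a F (Some a)).
Proof. by rewrite -big_enum enum_option big_cons big_map /= big_enum. Qed.

Lemma perm_codom_bij (A : finType) (T : eqType) (x0 : T) (c : A -> T) (C : seq T) :
  perm_eq C (codom c) ->
  exists2 phi : 'I_(size C) -> A, bijective phi & forall i : 'I_(size C), nth x0 C i = c (phi i).
Proof.
move=> h; have sz : size C = #|A| by rewrite (perm_size h) size_codom.
have /tuple_permP[p E] : perm_eq C (codom_tuple c) by [].
exists (fun i => enum_val (p (cast_ord sz i))).
  apply: bij_comp; first exact: enum_val_bij.
  apply: bij_comp; first by exists (p^-1)%g; [apply: permK|apply: permKV].
  by exists (cast_ord (esym sz)); [apply: cast_ordK|apply: cast_ordKV].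
move=> i; have -> : nat_of_ord i = cast_ord sz i by [].
move: (cast_ord sz i) => j; rewrite E -tnth_nth tnth_mktuple.
by rewrite (tnth_nth x0) /= nth_codom.
Qed.

Section Resolution.
Variable k : closedFieldType.
Local Notation R := {mpoly k[4]}.

Lemma homog_min (p : R) (d : nat * nat) : bihomog p d -> d != (0, 0)%N -> p@_0%MM = 0.
Proof.
move=> hp; apply: contraNeq; rewrite -mcoeff_msupp => /hp <-.
by rewrite /bideg !mnm0E.
Qed.

(** Resolutions indexed by finite types: adding a generator means passing to [option A], and the
    order of the bidegrees is settled only on conversion to sequences. *)
Record fres (I : R -> Prop) (A B : finType) (c : A -> nat * nat) (v : B -> nat * nat)
    (g : A -> R) (M : B -> A -> R) : Prop := Fres {
  fres_gen_homog : forall a, bihomog (g a) (c a);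
  fres_syz_homog : forall b a m, m \in msupp (M b a) -> addd (bideg m) (c a) = v b;
  fres_gen : forall p, I p <-> exists u : A -> R, p = \sum_a u a * g a;
  fres_syz : forall u : A -> R,
    \sum_a u a * g a = 0 <-> exists w : B -> R, forall a, u a = \sum_b w b * M b a;
  fres_inj : forall w : B -> R, (forall a, \sum_b w b * M b a = 0) -> forall b, w b = 0;
  fres_min : forall b a, (M b a)@_0%MM = 0 }.

Lemma fres_bigraded (I : R -> Prop) (A B : finType) c v g M C V :
  @fres I A B c v g M -> perm_eq C (codom c) -> perm_eq V (codom v) ->
  bigraded_min_resolution I C V.
Proof.
case=> gh sh gen syz inj min.
move=> /(perm_codom_bij (0, 0)%N)[phi bphi Ephi] /(perm_codom_bij (0, 0)%N)[psi bpsi Epsi].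
pose g' : 'cV[R]_(size C) := \col_i g (phi i).
pose M' : 'M[R]_(size V, size C) := \matrix_(i, j) M (psi i) (phi j).
have [phi' phiK phi'K] := bphi; have [psi' psiK psi'K] := bpsi.
have ug (u : A -> R) : ((\row_i u (phi i)) *m g') 0 0 = \sum_a u a * g a.
  rewrite mxE (reindex phi) /=; last exact: onW_bij.
  by apply: eq_bigr => i _; rewrite !mxE.
have rowE (u : 'rV[R]_(size C)) : u = \row_i u 0 (phi' (phi i)).
  by apply/rowP => i; rewrite mxE phiK.
have wM (w : B -> R) i : ((\row_j w (psi j)) *m M') 0 i = \sum_b w b * M b (phi i).
  rewrite mxE [RHS](reindex psi) /=; last exact: onW_bij.
  by apply: eq_bigr => j _; rewrite !mxE.
have rowE' (w : 'rV[R]_(size V)) : w = \row_j w 0 (psi' (psi j)).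
  by apply/rowP => i; rewrite mxE psiK.
exists g', M'; split; first by move=> i; rewrite mxE Ephi.
split; first by move=> i j m; rewrite mxE => /sh; rewrite Ephi Epsi => <-.
split.
  move=> p; split=> [/gen[u ->]|[u ->]]; first by exists (\row_i u (phi i)); rewrite ug.
  by apply/gen; exists (fun a => u 0 (phi' a)); rewrite -ug -rowE.
split.
  move=> u; split=> [hu|[w ->]].
    have /syz[w hw] : \sum_a u 0 (phi' a) * g a = 0 by rewrite -ug -rowE hu mxE.
    exists (\row_j w (psi j)); apply/rowP => i; by rewrite wM -hw phiK.
  apply/matrixP => i j; rewrite !ord1 [w *m M']rowE (ug (fun a => (w *m M') 0 (phi' a))) mxE; apply/syz.
  exists (fun b => w 0 (psi' b)) => a.
  by rewrite {1}[w]rowE' (wM (fun b => w 0 (psi' b))) phi'K.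
split; last by move=> i j; rewrite mxE.
move=> w hw; apply/rowP => j; rewrite mxE -[j]psiK.
apply: (inj (fun b => w 0 (psi' b))) => a.
by rewrite -[a]phi'K -wM -rowE' hw mxE.
Qed.

Section Step.
Variables (I I' : R -> Prop) (A B : finType) (c : A -> nat * nat) (v : B -> nat * nat).
Variables (g : A -> R) (M : B -> A -> R) (a0 : A) (L D F : R) (y dl : nat).
Hypothesis res : fres I' c v g M.
Hypothesis hL : bihomog L (1, 0)%N.
Hypothesis L0 : L != 0.
Hypothesis FE : F = D * g a0.
Hypothesis hD : bihomog D (0, dl)%N.
Hypothesis LF : forall u, divides L (u * F) -> divides L u.
Hypothesis IE : forall p, I p <-> exists h q, I' q /\ p = h * F + L * q.
Hypothesis ca0 : c a0 = (0, y)%N.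

(** F is a new generator [None], and L F = D (L g_a0) is the one new syzygy. It is minimal because D
    has positive degree. *)
Lemma fres_jump : (0 < dl)%N ->
  fres I (fun a => if a is Some a then addd (1, 0)%N (c a) else (0, y + dl)%N)
    (fun b => if b is Some b then addd (1, 0)%N (v b) else (1, y + dl)%N)
    (fun a => if a is Some a then L * g a else F)
    (fun b a => match b, a with
     | None, None => L
     | None, Some a => if a == a0 then - D else 0
     | Some b, None => 0
     | Some b, Some a => M b a end).
Proof.
case: res => gh sh gen syz inj min dl0; split.
- case=> [a|]; first exact: bihomogM.
  rewrite FE; have := bihomogM hD (gh a0).
  by rewrite ca0 /addd /= addnC.
- case=> [b|] [a|] m //=.
  + by move=> /sh <-; rewrite !adddA [addd (bideg m) _]adddC.
  + by rewrite msupp0.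
  + case: eqP => [->|_]; last by rewrite msupp0.
    by rewrite (perm_mem (msuppN D)) => /hD ->; rewrite ca0 /addd /=; congr pair; lia.
  + by move=> /hL ->; rewrite /addd /=; congr pair; lia.
- move=> p; rewrite IE; split.
    case=> h [q [/gen[u ->] ->]]; exists (fun a => if a is Some a then u a else h).
    rewrite big_option /= mulr_sumr; congr (_ + _); apply: eq_bigr => a _; ring.
  case=> u ->; exists (u None), (\sum_a u (Some a) * g a); split.
    by apply/gen; exists (fun a => u (Some a)).
  rewrite big_option /= mulr_sumr; congr (_ + _); apply: eq_bigr => a _; ring.
- move=> u; rewrite big_option /=; split.
    move=> h; have {}h : u None * F = L * - (\sum_a u (Some a) * g a).
      apply/eqP; rewrite mulrN -addr_eq0 mulr_sumr -[X in _ == X]h; apply/eqP; congr (_ + _).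
      by apply: eq_bigr => a _; ring.
    have [w Ew] : divides L (u None) by apply: LF; rewrite h; eexists.
    (* Removing w times the new syzygy clears the coefficient of F; what is left is L times a
       relation among the old generators. *)
    have /syz[w' hw'] : \sum_a (u (Some a) + (if a == a0 then w * D else 0)) * g a = 0.
      under eq_bigr => a _ do rewrite mulrDl.
      rewrite big_split /= (bigD1 a0 (P := predT) (F := fun a => (if a == a0 then _ else _) * _)) //= eqxx.
      rewrite [X in _ + (_ + X)]big1; last by move=> a /negPf->; rewrite mul0r.
      rewrite addr0 -mulrA -FE; apply: (mulfI L0).
      by move: h; rewrite Ew -mulrA => /(mulfI L0) ->; ring.
    exists (fun b => if b is Some b then w' b else w) => -[a|]; rewrite big_option /=.
      have := hw' a; case: ifP => _ E; rewrite -E; ring.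
    rewrite big1 => [|b _]; last by rewrite mulr0.
    by rewrite addr0 Ew mulrC.
  case=> w hw; have -> : u None = w None * L.
    by rewrite hw big_option /= big1 ?addr0 // => b _; rewrite mulr0.
  under eq_bigr => a _ do rewrite hw big_option /= mulrDl.
  rewrite big_split /= (bigD1 a0) //= eqxx [X in _ + (_ + X + _)]big1; last first.
    by move=> a /negPf->; rewrite mulr0 mul0r.
  have /(congr1 (fun x => L * x)) : \sum_a (\sum_b w (Some b) * M b a) * g a = 0.
    by apply/syz; exists (fun b => w (Some b)).
  rewrite mulr0 mulr_sumr => E; rewrite addr0 -[RHS]E addrA.
  rewrite (_ : w None * L * F + _ = 0) ?add0r; last by rewrite FE; ring.
  by apply: eq_bigr => a _; ring.
- move=> w hw; have w0 : w None = 0.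
    have := hw None; rewrite big_option /= big1 ?addr0; last by move=> b _; rewrite mulr0.
    by move/eqP; rewrite mulf_eq0 (negPf L0) orbF => /eqP.
  case=> [b|//]; apply: (inj (fun b => w (Some b))) => a.
  by have := hw (Some a); rewrite big_option /= w0 mul0r add0r.
- case=> [b|] [a|] //; rewrite ?mcoeff0 //; last exact: homog_min hL _.
  case: eqP => _; rewrite ?mcoeff0 // mcoeffN (homog_min hD) ?oppr0 //.
  by rewrite xpair_eqE /=; lia.
Qed.

(** Now F is the old generator g_a0 itself, which makes L g_a0 redundant. F takes its place, and the
    syzygy coefficients at [a0] absorb the factor L. *)
Lemma fres_collapse : D = 1 ->
  fres I (fun a => if a == a0 then c a else addd (1, 0)%N (c a)) (fun b => addd (1, 0)%N (v b))
    (fun a => if a == a0 then F else L * g a) (fun b a => if a == a0 then L * M b a else M b a).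
Proof.
case: res => gh sh gen syz inj min D1; have FE' : F = g a0 by rewrite FE D1 mul1r.
have sumE (u : A -> R) : \sum_a u a * (if a == a0 then F else L * g a) =
    u a0 * F + L * \sum_(a | a != a0) u a * g a.
  rewrite (bigD1 a0) //= eqxx mulr_sumr; congr (_ + _).
  by apply: eq_bigr => a /negPf->; ring.
have sumE' (u : A -> R) w : u a0 = L * w -> \sum_a u a * (if a == a0 then F else L * g a) =
    L * \sum_a (if a == a0 then w else u a) * g a.
  move=> Ew; rewrite sumE [in RHS](bigD1 a0) //= eqxx mulrDr Ew FE' mulrA; congr (_ + L * _).
  by apply: eq_bigr => a /negPf->.
split.
- by move=> a; case: eqP => [->|_]; rewrite ?FE' //; apply: bihomogM.
- move=> b a m; case: eqP => [->|_].
    move=> /msuppM_le /allpairsP[[m1 m2] /= [/hL h1 /sh <- ->]].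
    by rewrite bidegD h1 adddA.
  by move=> /sh <-; rewrite !adddA [addd (bideg m) _]adddC.
- move=> p; rewrite IE; split.
    case=> h [q [/gen[u ->] ->]]; exists (fun a => if a == a0 then h + L * u a0 else u a).
    rewrite sumE eqxx (bigD1 a0) //= -FE' mulrDr mulrDl addrA; congr (_ + _); first by ring.
    by congr (_ * _); apply: eq_bigr => a /negPf->.
  case=> u ->; exists (u a0), (\sum_(a | a != a0) u a * g a); split; last exact: sumE.
  apply/gen; exists (fun a => if a == a0 then 0 else u a); rewrite [RHS](bigD1 a0) //= eqxx mul0r add0r.
  by apply: eq_bigr => a /negPf->.
- move=> u; split=> [h|[w hw]].
    have [w Ew] : divides L (u a0).
      apply: LF; exists (- \sum_(a | a != a0) u a * g a); apply/eqP.
      by rewrite mulrN -addr_eq0 -sumE h.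
    have /syz[w' hw'] : \sum_a (if a == a0 then w else u a) * g a = 0.
      by apply: (mulfI L0); rewrite mulr0 -(sumE' _ _ Ew).
    exists w' => a; have := hw' a; case: eqP => [->|_] // E.
    by rewrite Ew E mulr_sumr; apply: eq_bigr => b _; ring.
  rewrite (sumE' _ (\sum_b w b * M b a0)); last first.
    by rewrite hw eqxx mulr_sumr; apply: eq_bigr => b _; ring.
  rewrite (_ : \sum_a _ = 0) ?mulr0 //; apply/syz; exists w => a.
  by case: eqP => [->//|/eqP/negPf ne]; rewrite hw ne.
- move=> w hw; apply: inj => a; have := hw a; case: eqP => // _ h.
  by apply: (mulfI L0); rewrite mulr0 -[RHS]h mulr_sumr; apply: eq_bigr => b _; ring.
- move=> b a; case: eqP => _ //; apply/eqP; rewrite mcoeff_eq0; apply/negP.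
  move=> /msuppM_le /allpairsP[[m1 m2] /= [/hL h1 _]] /(congr1 bideg).
  by rewrite bidegD h1 /bideg !mnm0E /addd.
Qed.

End Step.
End Resolution.

(** * Peeling off a dominant row *)

Definition shift1 (d : nat * nat) := addd (1, 0)%N d.

(* [Crec a] lists C_Z without its element (0, alpha_1), and [Vrec a] lists V_Z; the recursion
   follows the peeling of rows, which shifts the old generators and syzygies by (1, 0). *)
Fixpoint Crec (a : seq nat) : seq (nat * nat) :=
  if a is x :: s then
    map shift1 (if x == head 0%N s then Crec s else (0, head 0%N s)%N :: Crec s)
  else [::].

Fixpoint Vrec (a : seq nat) : seq (nat * nat) :=
  if a is x :: s then
    if x == head 0%N s then map shift1 (Vrec s) else (1, x)%N :: map shift1 (Vrec s)
  else [::].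

(** The descents of [a], indexed from 0. [F] receives the position and the entries after and before
    the descent, so one recursion serves both C_Z and V_Z. *)
Definition jumps (F : nat -> nat -> nat -> nat * nat) (a : seq nat) :=
  [seq F i.+1 (nth 0%N a i.+1) (nth 0%N a i) |
    i <- iota 0 (size a).-1 & (nth 0%N a i.+1 < nth 0%N a i)%N].

Lemma jumpsE F a :
  [seq F i.-1 (nth 0%N a i.-1) (nth 0%N a i.-2) |
    i <- iota 2 (size a).-1 & (nth 0%N a i.-1 < nth 0%N a i.-2)%N] = jumps F a.
Proof. by rewrite -[2%N]/(2 + 0)%N iotaDl filter_map -map_comp. Qed.

Lemma jumps_cons F x y s : (forall i u v, F i.+2 u v = shift1 (F i.+1 u v)) ->
  jumps F (x :: y :: s) =
  (if (y < x)%N then [:: F 1%N y x] else [::]) ++ map shift1 (jumps F (y :: s)).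
Proof.
move=> hF; rewrite /jumps -[(size _).-1]/(size s).+1 -map_comp.
rewrite -[iota 0 (size s).+1]/(0%N :: iota (1 + 0) (size s)) iotaDl /= filter_map.
have E : [seq F i.+1 (nth 0%N [:: x, y & s] i.+1) (nth 0%N [:: x, y & s] i)
  | i <- [seq (1 + j)%N | j <- iota 0 (size s) & (nth 0%N (y :: s) j.+1 < nth 0%N (y :: s) j)%N]] =
  [seq shift1 (F i.+1 (nth 0%N (y :: s) i.+1) (nth 0%N (y :: s) i))
  | i <- iota 0 (size s) & (nth 0%N (y :: s) i.+1 < nth 0%N (y :: s) i)%N].
  by rewrite -map_comp; apply: eq_map => i /=; rewrite -hF.
by case: ifP => _ /=; [congr cons|]; exact: E.
Qed.

Lemma perm_swap (T : eqType) (x y : T) s : perm_eq (x :: y :: s) (y :: x :: s).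
Proof. by have /permPl := perm_catCA [:: x] [:: y] s. Qed.

(** The default head 0 of the empty list makes the end of a positive sequence a descent to 0, which
    yields (1, 0) and, after the remaining shifts, (m, 0). For V_Z the same descent yields (m,
    alpha_m). *)
Lemma Crec_perm a : a != [::] -> sorted geq a -> all (leq 1) a ->
  perm_eq (CZ a) ((0, head 0 a)%N :: Crec a).
Proof.
case: a => // x s _ hs hpos; rewrite /CZ (jumpsE (fun i u v => (i, u))) /=.
suff h : perm_eq (((size s).+1, 0%N) :: jumps (fun i u v => (i, u)) (x :: s)) (Crec (x :: s)).
  by rewrite (permPl (perm_swap _ _ _)) perm_cons.
elim: s x hs hpos => [|y s IH] x /=; first by case: x.
move=> /andP[yx hs] /andP[_ hpos]; rewrite jumps_cons //.
have := perm_map shift1 (IH y hs hpos); rewrite ltn_neqAle eq_sym [(y <= x)%N]yx andbT.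
by case: eqP => _ //= h; rewrite (permPl (perm_swap _ _ _)) perm_cons.
Qed.

Lemma Vrec_perm a : a != [::] -> sorted geq a -> all (leq 1) a -> perm_eq (VZ a) (Vrec a).
Proof.
case: a => // x s _; rewrite /VZ (jumpsE (fun i u v => (i, v))).
elim: s x => [|y s IH] x /=; first by case: x.
move=> /andP[yx hs] /andP[_ hpos]; rewrite jumps_cons //.
have := perm_map shift1 (IH y hs hpos); rewrite ltn_neqAle eq_sym [(y <= x)%N]yx andbT.
by case: eqP => _ //= h; rewrite (permPl (perm_swap _ _ _)) perm_cons.
Qed.

Lemma codom_split (A : finType) (T : eqType) (c : A -> T) a0 :
  perm_eq (codom c) (c a0 :: [seq c a | a <- enum A & a != a0]).
Proof.
rewrite /codom /image_mem -[_ :: _]/(map c (a0 :: _)); apply: perm_map.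
rewrite -(rem_filter _ (enum_uniq A)); apply: perm_to_rem; by rewrite mem_enum.
Qed.

(** * How alpha_Z changes when a row is peeled *)

Section AlphaZ.
Variables (r t : nat).
Implicit Types mu : 'I_r -> 'I_t -> nat.

Definition arow mu i := [seq a_ik mu i k | k <- iota 0 (l_i mu i)].

Lemma alphaZ_sorted mu : sorted geq (alphaZ mu).
Proof. by apply: sort_sorted => x y; apply: leq_total. Qed.

Lemma mem_alphaZ mu x : x \in alphaZ mu -> exists i l, (l < l_i mu i)%N /\ x = a_ik mu i l.
Proof.
rewrite mem_sort => /flatten_mapP[i _ /mapP[l]]; rewrite mem_iota => hl ->.
by exists i, l; split.
Qed.

Lemma alphaZ_pos mu : all (leq 1) (alphaZ mu).
Proof.
apply/allP => x /mem_alphaZ[i [l [hl ->]]]; rewrite lt0n; apply: contraL hl => /eqP.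
rewrite /a_ik => /eqP; rewrite sum_nat_eq0 => /forallP h; rewrite -leqNgt.
by apply/bigmax_leqP => j _; rewrite -subn_eq0; apply: h.
Qed.

Lemma alphaZ_neq0 mu i j : (0 < mu i j)%N -> alphaZ mu != [::].
Proof.
move=> h; have : a_ik mu i 0 \in alphaZ mu.
  rewrite mem_sort; apply/flatten_mapP; exists i; first by rewrite mem_enum.
  apply/mapP; exists 0%N => //; rewrite mem_iota /=; apply: leq_trans h _.
  exact: leq_bigmax.
by case: (alphaZ mu).
Qed.

Lemma alphaZ0 mu : (forall i j, mu i j = 0%N) -> alphaZ mu = [::].
Proof.
move=> h; case E: (alphaZ mu) => [//|x s].
have /mem_alphaZ[i [l [hl _]]] : x \in alphaZ mu by rewrite E mem_head.
by move: hl; rewrite /l_i big1 // => j _; apply: h.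
Qed.

Definition total_rows mu := forall i i' a b,
  (forall j, (mu i j - a <= mu i' j - b)%N) \/ (forall j, (mu i' j - b <= mu i j - a)%N).

Definition peel mu i : 'I_r -> 'I_t -> nat :=
  fun i' j => if i' == i then (mu i' j).-1 else mu i' j.

(** Cutting the peeled row at a is cutting the original row at a + 1, so the order on all
    truncations is inherited. *)
Lemma peel_total mu i : total_rows mu -> total_rows (peel mu i).
Proof.
move=> h i1 i2 a b; pose sh i' a := if i' == i then a.+1 else a.
have E i' a' j : (peel mu i i' j - a' = mu i' j - sh i' a')%N.
  by rewrite /peel /sh; case: eqP => _; lia.
by have [h'|h'] := h i1 i2 (sh i1 a) (sh i2 b); [left|right] => j; rewrite !E.
Qed.

Lemma sort_geq_cons (x : nat) s1 s2 :
  perm_eq s1 (x :: s2) -> all (geq x) s2 -> sort geq s1 = x :: sort geq s2.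
Proof.
move=> h hx; have tr : transitive geq by move=> a b c /= ab bc; apply: leq_trans ab.
have tot : total geq by move=> a b; apply: leq_total.
apply: (sorted_eq tr).
- by move=> a b /= h'; apply/eqP; rewrite eqn_leq andbC.
- exact: sort_sorted.
- by rewrite /= path_sortedE // all_sort hx sort_sorted.
by rewrite perm_sort (perm_trans h) // perm_cons perm_sym perm_sort.
Qed.

(** The sum of the dominant row is the largest entry. Peeling turns a_(i,k+1) into a_(i,k) and
    lowers l_i by one, so exactly this entry disappears. *)
Lemma alphaZ_peel mu i j : (0 < mu i j)%N -> (forall i' j', (mu i' j' <= mu i j')%N) ->
  alphaZ mu = (\sum_j' mu i j')%N :: alphaZ (peel mu i).
Proof.
move=> mu0 hi; rewrite /alphaZ; apply: sort_geq_cons; last first.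
  apply/allP => x /flatten_mapP[i' _ /mapP[l _ ->]]; rewrite /= /a_ik.
  apply: leq_sum => j' _; rewrite /peel; have := hi i' j'; case: ifP => _; lia.
have ne i' : i' != i -> arow mu i' = arow (peel mu i) i'.
  by move=> /negPf ne; rewrite /arow /a_ik /l_i /peel ne.
have li : l_i mu i = (l_i (peel mu i) i).+1.
  apply/eqP; rewrite eqn_leq; apply/andP; split.
    apply/bigmax_leqP => j' _.
    have : (peel mu i i j' <= l_i (peel mu i) i)%N by apply: leq_bigmax.
    by rewrite /peel eqxx; lia.
  have l0 : (0 < l_i mu i)%N by apply: leq_trans mu0 _; apply: leq_bigmax.
  suff : (l_i (peel mu i) i <= (l_i mu i).-1)%N by lia.
  apply/bigmax_leqP => j' _; rewrite /peel eqxx.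
  have : (mu i j' <= l_i mu i)%N by apply: leq_bigmax.
  by lia.
have rowi : arow mu i = (\sum_j' mu i j')%N :: arow (peel mu i) i.
  rewrite /arow li /= -[(1 : nat)%N]addn0 iotaDl -map_comp; congr cons.
    by apply: eq_bigr => j' _; rewrite subn0.
  apply: eq_map => l /=; apply: eq_bigr => j' _; rewrite /peel eqxx; lia.
have pe : perm_eq (enum 'I_r) (i :: rem i (enum 'I_r)) by apply: perm_to_rem; rewrite mem_enum.
rewrite (perm_trans (perm_flatten (perm_map (arow mu) pe))) //= rowi /= perm_cons perm_sym.
rewrite (perm_trans (perm_flatten (perm_map (arow (peel mu i)) pe))) //= perm_cat2l.
rewrite (_ : map _ _ = map (arow mu) (rem i (enum 'I_r))) //.
apply/eq_in_map => i'; rewrite mem_rem_uniq ?enum_uniq // !inE => /andP[/ne ->] //.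
Qed.

(** Among pairwise comparable rows, one with maximal sum is the largest. *)
Lemma dominant_row mu (i0 : 'I_r) : total_rows mu ->
  exists i, forall i' j, (mu i' j <= mu i j)%N.
Proof.
move=> h; have [i _ hi] := @arg_maxnP _ i0 predT (fun i => \sum_j mu i j)%N isT.
exists i => i'; have [h'|h'] := h i' i 0%N 0%N => j; have := h' j; rewrite !subn0 // => hj.
rewrite leqNgt; apply/negP => lt; have := hi i' isT; rewrite /= leqNgt => /negP[].
rewrite (bigD1 j) //= [X in (_ < X)%N](bigD1 j) //= -addSn leq_add // leq_sum // => j' _.
by have := h' j'; rewrite !subn0.
Qed.

End AlphaZ.

(** * Induction on the length of alpha_Z *)

Section Peeling.
Variables (k : closedFieldType) (r t : nat).
Variables (Rp : 'I_r -> k * k) (Qp : 'I_t -> k * k).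
Local Notation R := {mpoly k[4]}.
Local Notation L i := (lin false (Rp i)).
Local Notation V j := (lin true (Qp j)).
Hypothesis hRpt : forall i, P1pt (Rp i).
Hypothesis hQpt : forall j, P1pt (Qp j).
Hypothesis hRd : forall i i', i != i' -> P1_distinct (Rp i) (Rp i').
Hypothesis hQd : forall j j', j != j' -> P1_distinct (Qp j) (Qp j').
Implicit Types mu : 'I_r -> 'I_t -> nat.

Lemma sum_unit (F : unit -> R) : \sum_a F a = F tt.
Proof. by rewrite (big_pred1 tt) // => -[]. Qed.

Lemma sum_void (F : void -> R) : \sum_b F b = 0.
Proof. by rewrite big1 // => -[]. Qed.

(** Modulo L_i, an element of I_Z is a multiple of the product of the V_j^(mu_ij), and dominance
    puts this product itself in I_Z. The rest is L_i q in I_Z, and cancelling L_i lowers only the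
    exponents of row i. *)
Lemma IZ_peel mu i p : (forall i' j, (mu i' j <= mu i j)%N) ->
  IZ Rp Qp mu p <->
  exists h q, IZ Rp Qp (peel mu i) q /\ p = h * (\prod_j V j ^+ mu i j) + L i * q.
Proof.
move=> hi; have hI := IZ_ideal Rp Qp mu.
have IF : IZ Rp Qp mu (\prod_j V j ^+ mu i j).
  apply/IZP => i' j; rewrite (bigD1 j) //=; apply: ideal_mulr; first exact: powI_ideal.
  by rewrite -[_ ^+ _]mul1r -(expr0 (L i')); apply: powI_exp; rewrite add0n.
split=> [hp|[h [q [/IZP hq ->]]]].
  have [|q [h E]] := @powI_mod_prod k false (Rp i) _ (index_enum 'I_t) Qp (mu i) p
    (index_enum_uniq _) (hRpt i) (fun j j' _ _ => @hQd j j').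
    by move=> j _; move/IZP: hp; apply.
  exists h, q; split; last by rewrite E addrC mulrC.
  have /IZP hq : IZ Rp Qp mu (L i * q).
    rewrite (_ : L i * q = p - h * \prod_j V j ^+ mu i j); last by rewrite E /=; ring.
    by apply: (ideal_subr hI) => //; apply: (ideal_mull _ hI).
  apply/IZP => i' j; have := hq i' j; rewrite /peel; case: eqP => [->|/eqP ne].
    by case: (mu i j) => // m; apply: (powI_lin_same (s := false)).
  exact: (powI_lin_other (s := false) (hRd ne)).
apply: (ideal_addr hI); first exact: (ideal_mull _ hI).
apply/IZP => i' j; have := hq i' j; rewrite /peel; case: eqP => [->|_].
  by case: (mu i j) => // m; apply: powIS.
by move=> hq'; apply: ideal_mull => //; apply: powI_ideal.
Qed.

Lemma lin_neq0 s (a : k * k) : P1pt a -> lin s a != 0.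
Proof.
move=> /P1_complement[b hb]; have [Phi bPhi [<- _ _ _]] := lin_coords s hb hb.
rewrite -(rmorph0 Phi) (inj_eq (bij_inj bPhi)); apply/eqP => /mpolyP /(_ U_(var s false)%MM).
by rewrite mcoeffX eqxx mcoeff0 => /eqP; rewrite oner_eq0.
Qed.

(** The induction carries a marked generator [a0], the pure y-form of bidegree (0, alpha_1), because
    the next peeling step expresses its new form F as a multiple of it. *)
Lemma fres_total_rows mu : total_rows mu ->
  exists (A B : finType) (c : A -> nat * nat) (v : B -> nat * nat) g M (a0 : A),
  [/\ fres (IZ Rp Qp mu) c v g M, g a0 = \prod_j V j ^+ (\max_i mu i j),
      c a0 = (0, head 0 (alphaZ mu))%N /\ head 0%N (alphaZ mu) = (\sum_j \max_i mu i j)%N,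
      perm_eq [seq c a | a <- enum A & a != a0] (Crec (alphaZ mu)) &
      perm_eq (codom v) (Vrec (alphaZ mu))].
Proof.
have [n] := ubnP (size (alphaZ mu)); elim: n mu => // n IH mu hn tot.
(* With all multiplicities 0 the ideal is R, generated by 1 without syzygies. *)
have [[i0 j0] /= mu0|mu00] := pickP (fun ij : 'I_r * 'I_t => 0 < mu ij.1 ij.2)%N; last first.
  have mu0 i j : mu i j = 0%N by have := mu00 (i, j); rewrite /=; lia.
  have max0 j : \max_i mu i j = 0%N by rewrite big1 // => i _.
  exists unit, void, (fun=> (0, 0)%N), (fun b : void => (0, 0)%N), (fun=> 1), (fun _ _ => 0), tt.
  rewrite alphaZ0 //; split=> //=.
  - split=> //.
    + by move=> _; apply: bihomog1.
    + by move=> p; split=> _; [exists (fun=> p); rewrite sum_unit mulr1|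
        apply/IZP => i j; rewrite mu0].
    + move=> u; rewrite sum_unit mulr1; split=> [h|[w h]].
        by exists (fun=> 0) => -[]; rewrite h sum_void.
      by rewrite h sum_void.
  - by rewrite big1 // => j _; rewrite max0.
  - by split=> //; rewrite big1.
  - by rewrite enumT unlock /=.
  - by rewrite /codom /image_mem enumT unlock.
have [i hi] := dominant_row i0 tot.
have mui0 : (0 < mu i j0)%N by apply: leq_trans mu0 _.
have aE := alphaZ_peel mui0 hi.
have maxE j : \max_i' mu i' j = mu i j.
  by apply/eqP; rewrite eqn_leq leq_bigmax andbT; apply/bigmax_leqP.
have [|A [B [c [v [g [M [a0 [res ga0 [ca0 hd] pc pv]]]]]]]] := IH (peel mu i) _ (peel_total i tot).
  by move: hn; rewrite aE.
pose m' j := \max_i' peel mu i i' j.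
have m'le j : (m' j <= mu i j)%N.
  apply/bigmax_leqP => i' _; rewrite /peel; have := hi i' j; case: ifP; lia.
pose D := \prod_j V j ^+ (mu i j - m' j); pose F := \prod_j V j ^+ mu i j.
have FE : F = D * g a0.
  rewrite ga0 -big_split /=; apply: eq_bigr => j _; rewrite -exprD subnK //.
have hD : bihomog D (0, \sum_j (mu i j - m' j))%N by apply: (@bihomog_prod k true).
have hL : bihomog (L i) (1, 0)%N by apply: (@bihomog_lin k false).
have L0 : L i != 0 by apply: lin_neq0.
have LF u : divides (L i) (u * F) -> divides (L i) u.
  rewrite mulrC; apply: strip_prod => j q _; exact: (divides_lin_other (s := false)).
have IE p := IZ_peel p hi.
have sumE : (head 0 (alphaZ (peel mu i)) + \sum_j (mu i j - m' j) = \sum_j mu i j)%N.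
  by rewrite hd -big_split /=; apply: eq_bigr => j _; rewrite -/(m' j) subnKC.
have sumE' : (\sum_j mu i j)%N = (\sum_j \max_i' mu i' j)%N by apply: eq_bigr => j _; rewrite maxE.
have FE' : F = \prod_j V j ^+ (\max_i' mu i' j) by apply: eq_bigr => j _; rewrite maxE.
(* The degree of D is the drop from the first to the second entry of alpha_Z (0 if there is no
   second); whether it vanishes decides between the two kinds of step. *)
have [dl0|dlp] := posnP (\sum_j (mu i j - m' j))%N.
  have D1 : D = 1.
    rewrite /D big1 // => j _; move/eqP: dl0; rewrite sum_nat_eq0 => /forallP /(_ j) /= /eqP ->.
    by rewrite expr0.
  have := fres_collapse res hL L0 FE LF IE D1 => res'.
  do 6!eexists; exists a0; split; first exact: res'.
  - by rewrite /= eqxx.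
  - by rewrite /= eqxx ca0 aE /= -sumE dl0 addn0 -sumE' -sumE dl0 addn0.
  - rewrite aE /= -sumE dl0 addn0 eqxx -(permPr (perm_map shift1 pc)) -map_comp.
    rewrite (_ : map _ _ = map (shift1 \o c) [seq a <- enum A | a != a0]) //.
    by apply/eq_in_map => a; rewrite mem_filter => /andP[/negPf-> _].
  - rewrite aE /= -sumE dl0 addn0 eqxx -(permPr (perm_map shift1 pv)) /codom /image_mem -(map_comp shift1).
    exact: perm_refl.
have := fres_jump res hL L0 FE hD LF IE ca0 dlp => res'.
have ne : ((\sum_j mu i j)%N == head 0%N (alphaZ (peel mu i))) = false by apply/eqP; lia.
do 6!eexists; exists None; split; first exact: res'.
- by [].
- by rewrite aE /= sumE.
- have pc' : perm_eq (codom c) ((0, head 0 (alphaZ (peel mu i)))%N :: Crec (alphaZ (peel mu i))).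
    by rewrite (permPl (codom_split c a0)) ca0 perm_cons.
  rewrite aE [Crec _]/= ne; apply: perm_trans (perm_map shift1 pc').
  rewrite enum_option /= filter_map -map_comp (eq_filter (a2 := predT)) // filter_predT.
  by rewrite /codom /image_mem -(map_comp shift1).
- rewrite aE /= ne /codom /image_mem enum_option /= -map_comp sumE perm_cons.
  by rewrite -(permPr (perm_map shift1 pv)) /codom /image_mem -(map_comp shift1).
Qed.

End Peeling.

Theorem theorem4p11 (k : closedFieldType) (r t : nat)
  (Rp : 'I_r -> k * k) (Qp : 'I_t -> k * k) (mu : 'I_r -> 'I_t -> nat)
  (hr : (0 < r)%N)
  (hRpt : forall i, P1pt (Rp i)) (hQpt : forall j, P1pt (Qp j))
  (hRd : forall i i', i != i' -> P1_distinct (Rp i) (Rp i'))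
  (hQd : forall j j', j != j' -> P1_distinct (Qp j) (Qp j'))
  (hrow : forall i, exists j, (0 < mu i j)%N)
  (hcol : forall j, exists i, (0 < mu i j)%N)
  (hACM : CohenMacaulay_quot (IZ Rp Qp mu)) :
  bigraded_min_resolution (IZ Rp Qp mu) (CZ (alphaZ mu)) (VZ (alphaZ mu)).
Proof.
have tot : total_rows mu by move=> i i' a b; apply: (CM_total_order hRpt hQpt hRd hQd).
have [A [B [c [v [g [M [a0 [res _ [ca0 _] pc pv]]]]]]]] := fres_total_rows hRpt hQpt hRd hQd tot.
(* A positive multiplicity makes alpha_Z nonempty, as the comparison of C_Z and V_Z with their
   recursive forms requires. *)
have [j mu0] := hrow (Ordinal hr); have a_ne := alphaZ_neq0 mu0.
have hs := alphaZ_sorted mu; have hpos := alphaZ_pos mu.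
apply: (fres_bigraded res); last by rewrite (permPl (Vrec_perm a_ne hs hpos)) perm_sym.
rewrite (permPl (Crec_perm a_ne hs hpos)) -ca0.
by rewrite perm_sym (permPl (codom_split c a0)) perm_cons.
Qed.
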